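(* Let $a,b>0$, let $c>0$, and let $u$ be the unique continuous solution on $[0,+\infty)$ to $$\mathfrak{D}_t^\Phi u(t)=-c\,u(t),\qquad u(0)=1 .$$ Let $L_t$ be the inverse to the gamma subordinator with Laplace exponent $\Phi(\lambda)=a\ln(1+\lambda/b)$. Then: (i) $u(t)=\mathbf{E}_0[e^{-cL_t}]$; (ii) $u(t)$ has the representation $$u(t)=1-\frac{c}{a}\,e^{-bt}\sum_{n=0}^\infty e^{\frac{c}{a}n}\,\nu\!\left(bt\,e^{-\frac{c}{a}},n\right)=1-b\,\frac{c}{a}\,e^{-\frac{c}{a}}\int_0^t e^{-bs}\,\nu\!\left(bs\,e^{-\frac{c}{a}},-1\right)ds .$$
   Context: Fix $a,b>0$. The gamma subordinator $H=\{H_t\}_{t\ge0}$ is the subordinator started at $H_0=0$ with $\mathbf{E}_0[e^{-\lambda H_t}]=e^{-t\Phi(\lambda)}$, $\lambda\ge0$, where $\Phi(\lambda)=a\ln(1+\lambda/b)=a\int_0^\infty(1-e^{-\lambda y})\frac{e^{-by}}{y}\,dy$. The inverse process is $L_t=\inf\{s>0:H_s\notin(0,t)\}$, $t>0$, with $L_0=0$. The tail of the Lévy measure is $\overline{\Pi}(t)=a\int_t^\infty\frac{e^{-by}}{y}\,dy$, $t>0$. The Caputo–Dzherbashian type operator is $$\mathfrak{D}_t^\Phi u(t)=\int_0^t u'(s)\,\overline{\Pi}(t-s)\,ds,\qquad u\in AC(0,\infty),$$ where $AC(0,\infty)$ is the set of continuous functions on $(0,\infty)$ with $u'\in L^1(0,\infty)$.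 For $\alpha\in\mathbb{R}$, $x>0$, $\nu(x,\alpha)=\int_0^\infty\frac{x^{\alpha+y}}{\Gamma(\alpha+y+1)}\,dy$ (with $1/\Gamma$ the entire reciprocal gamma function). *)

(* Defs.v *)
From HB Require Import structures.
From mathcomp Require Import all_boot all_order all_algebra.
From mathcomp Require Import all_classical all_reals all_analysis.
Set Implicit Arguments.
Unset Strict Implicit.
Unset Printing Implicit Defensive.
Import Order.TTheory GRing.Theory Num.Theory.
Import numFieldNormedType.Exports.
Local Open Scope classical_set_scope.
Local Open Scope ring_scope.

Definition Phi {R : realType} (a b l : R) : R := a * ln (1 + l / b).

Definition levy_tail {R : realType} (a b t : R) : R :=
  a * \int[lebesgue_measure]_(y in `]t, +oo[) (expR (- (b * y)) / y).

Section process.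
Context {R : realType} {d : measure_display} {T : measurableType d}.

(* Time ranges over R; only the times t >= 0 are constrained or used. *)
Definition independent_increments (P : probability T R)
    (H : R -> {RV P >-> R}) : Prop :=
  forall (n : nat) (t : nat -> R) (B : nat -> set R),
    0 <= t 0%N -> (forall i, t i <= t i.+1) -> (forall i, measurable (B i)) ->
    P [set w | forall i, (i < n)%N -> B i (H (t i.+1) w - H (t i) w)] =
    (\prod_(i < n) P [set w | B i (H (t i.+1) w - H (t i) w)%R])%E.

Definition stationary_increments (P : probability T R)
    (H : R -> {RV P >-> R}) : Prop :=
  forall (s t : R) (B : set R), 0 <= s -> 0 <= t -> measurable B ->
    P [set w | B (H (s + t) w - H s w)] = P [set w | B (H t w)].

Record subordinator (P : probability T R) (H : R -> {RV P >-> R}) : Prop := {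
  subordinator0 : forall w, H 0 w = 0 ;
  subordinator_nondecreasing :
    forall w s t, 0 <= s -> s <= t -> H s w <= H t w ;
  subordinator_right_continuous :
    forall w t, 0 <= t -> H s w @[s --> t^'+] --> H t w ;
  subordinator_independent : independent_increments H ;
  subordinator_stationary : stationary_increments H }.

Definition gamma_subordinator (a b : R) (P : probability T R)
    (H : R -> {RV P >-> R}) : Prop :=
  subordinator H /\
  forall t l, 0 <= t -> 0 <= l ->
    ('E_P[fun w => expR (- (l * H t w))] = (expR (- (t * Phi a b l)))%:E)%E.

(* The infimum is taken in \bar R, so that it is +oo on the empty set. *)
Definition inverse_process (H : R -> T -> R) (t : R) (w : T) : \bar R :=
  if t == 0 then 0%E
  else ereal_inf [set s%:E | s in [set s : R | 0 < s /\ ~ (0 < H s w < t)]].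

End process.

(* u' is required to be the derivative of u in the absolutely continuous
   sense: besides existing almost everywhere and being integrable on
   ]0, +oo[, it has u as a primitive.  Without the last clause Cantor-like
   functions would be allowed. *)
Definition AC_halfline {R : realType} (u : R -> R) : Prop :=
  [/\ {within `]0, +oo[, continuous u},
      {ae lebesgue_measure, forall t : R, 0 < t -> derivable u t 1},
      lebesgue_measure.-integrable `]0, +oo[ (EFin \o derive1 u) &
      forall s t : R, 0 < s -> s <= t ->
        u t - u s = \int[lebesgue_measure]_(r in `[s, t]) derive1 u r].

(* With values in \bar R: since (+oo) - (+oo) is -oo, this integral is finite
   only if the integrand is Lebesgue integrable. *)
Definition caputo {R : realType} (a b : R) (u : R -> R) (t : R) : \bar R :=
  (\int[lebesgue_measure]_(s in `]0%R, t[)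
     (derive1 u s * levy_tail a b (t - s))%:E)%E.

Definition caputo_solution {R : realType} (a b c : R) (u : R -> R) : Prop :=
  [/\ {within `[0, +oo[, continuous u},
      AC_halfline u,
      u 0 = 1 &
      forall t, 0 < t -> caputo a b u t = (- (c * u t))%:E].

Definition Gamma {R : realType} (x : R) : R :=
  \int[lebesgue_measure]_(s in `]0, +oo[) (s `^ (x - 1) * expR (- s)).

(* The entire function 1 / Gamma on the real line, by the recurrence
   1 / Gamma x = x (x + 1) ... (x + n - 1) / Gamma (x + n), where n is the
   least natural number with 0 < x + n; in particular n = 0 if 0 < x. *)
Definition rGamma {R : realType} (x : R) : R :=
  let n := Num.truncn (1 - x) in
  (\prod_(i < n) (x + i%:R)) / Gamma (x + n%:R).

Definition nu {R : realType} (x alpha : R) : R :=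
  \int[lebesgue_measure]_(y in `]0, +oo[)
    (x `^ (alpha + y) * rGamma (alpha + y + 1)).

(* Main.v *)
(** Put kappa = c / a, let g_y be the density of the Gamma(y, b) law, G_y its
    distribution function, h(x) = int_x^oo e^(-b z) / z dz (so that the Levy tail
    is a h) and r(s) = int_0^oo e^(-kappa y) g_y(s) dy.  Everything rests on the
    identity r * (h + kappa) = 1, valid at every t > 0: the semigroup property
    g_y * g_e = g_(y+e) gives G_y - G_(y+e) = g_y * (1 - G_e), one integrates
    this against e^(-kappa y) dy / e and lets e tend to 0, since (1 - G_e) / e
    tends to h.  Hence u = 1 - kappa int_0^t r is a solution.  Conversely a
    solution satisfies u' * (h + kappa) = - kappa, and convolving with r gives
    u - 1 = - kappa int_0^t r.

    Finite measures on the half-line with the same Laplace transform have the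
    same distribution function, because 1 - (1 - e^(-m x))^M tends to the
    indicator of x < theta for suitable m and M tending to infinity.  This
    yields both the semigroup property and P(H_s < t) = G_(a s)(t).  Since
    {L_t <= s} = {H_s >= t} almost surely, (i) follows from Fubini's theorem;
    (ii) follows from G_y(t) - G_(y+1)(t) = e^(-b t) (b t)^y / Gamma(y + 1). *)

Require Import Defs.
From HB Require Import structures.
From mathcomp Require Import all_boot all_order all_algebra.
From mathcomp Require Import all_classical all_reals all_analysis.
From mathcomp Require Import measurable_realfun.
From mathcomp Require Import ring lra.
Set Implicit Arguments.
Unset Strict Implicit.
Unset Printing Implicit Defensive.
Import Order.TTheory GRing.Theory Num.Theory.
Import numFieldNormedType.Exports.
Local Open Scope classical_set_scope.
Local Open Scope ring_scope.

(** * Tonelli's theorem on rectangles and affine changes of variable *)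

Section integration_tools.
Context {R : realType}.
Local Notation mu := (@lebesgue_measure R).

(** The identity for [r] is dictated by Laplace transforms in time: [g_y] has transform
    [(1 + l / b) ^ (- y)], hence [r] has [1 / (kappa + ln (1 + l / b))], while [h + kappa] has
    [(ln (1 + l / b) + kappa) / l]; the product [1 / l] is the transform of the constant 1. By
    itself this gives the identity for almost every [t], whereas the equation is imposed at every
    [t > 0]; hence the limit in [e], which is taken at a fixed [t]. The obstacle to that limit is a
    pair of singularities: [h] is unbounded at 0 and so is [g_y] for [y < 1], so that [r * h] is not
    known to be finite in advance. The bound on [(1 - G_e) / e] that is uniform in [e] is a multiple
    of [h + 1], so Fatou's lemma has to supply the finiteness before dominated convergence applies.
    For uniqueness [u'] is merely integrable and has no sign. Fubini's theorem still applies to the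
    triple convolution, because [r] and the kernel are nonnegative and their convolution is the
    constant 1. *)

Lemma measurable_natr_bool : measurable_fun setT (fun b : bool => b%:R : R).
Proof. by []. Qed.

Lemma measurable_ltR d (T : measurableType d) (D : set T) (f g : T -> R) :
  measurable_fun D f -> measurable_fun D g ->
  measurable_fun D (fun x => (f x < g x)%R%:R : R).
Proof.
move=> mf mg; apply: (measurableT_comp measurable_natr_bool).
exact: measurable_fun_ltr.
Qed.

Lemma measurable_leR d (T : measurableType d) (D : set T) (f g : T -> R) :
  measurable_fun D f -> measurable_fun D g ->
  measurable_fun D (fun x => (f x <= g x)%R%:R : R).
Proof.
move=> mf mg; apply: (measurableT_comp measurable_natr_bool).
exact: measurable_fun_ler.
Qed.

Lemma ge0_integrable d (T : measurableType d) (m : {measure set T -> \bar R})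
    (D : set T) (f : T -> \bar R) :
  measurable_fun D f -> (forall x, D x -> 0 <= f x)%E ->
  (\int[m]_(x in D) f x < +oo)%E -> m.-integrable D f.
Proof.
move=> mf f0 foo; apply/integrableP; split => //.
suff -> : (\int[m]_(x in D) `|f x| = \int[m]_(x in D) f x)%E by [].
by apply: eq_integral => x /set_mem Dx; rewrite gee0_abs// f0.
Qed.

Lemma ge0_integralMl d (T : measurableType d) (m : {measure set T -> \bar R})
    (D : set T) (k : R) (f : T -> R) :
  measurable D -> 0 <= k -> measurable_fun setT f -> (forall x, 0 <= f x) ->
  (\int[m]_(x in D) (k * f x)%:E = k%:E * \int[m]_(x in D) (f x)%:E)%E.
Proof.
move=> mD k0 mf f0; under eq_integral do rewrite EFinM.
rewrite ge0_integralZl//; last by move=> x _; rewrite lee_fin.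
by apply/measurable_EFinP; exact: measurable_funTS.
Qed.

(** Extension by 0 outside the rectangle reduces the exchange to the whole product space. *)
Lemma fubini_tonelli_on d1 d2 (T1 : measurableType d1) (T2 : measurableType d2)
    (m1 : {sigma_finite_measure set T1 -> \bar R})
    (m2 : {sigma_finite_measure set T2 -> \bar R})
    (D1 : set T1) (D2 : set T2) (f : T1 * T2 -> \bar R) :
  measurable D1 -> measurable D2 -> measurable_fun setT f ->
  (forall x, 0 <= f x)%E ->
  (\int[m1]_(x in D1) \int[m2]_(y in D2) f (x, y) =
   \int[m2]_(y in D2) \int[m1]_(x in D1) f (x, y))%E.
Proof.
move=> mD1 mD2 mf f0.
pose g := f \_ (D1 `*` D2).
have mg : measurable_fun setT g.
  apply/(measurable_restrictT f) => //; first exact: measurableX.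
  exact: measurable_funTS.
have g0 x : (0 <= g x)%E by rewrite /g patchE; case: ifP.
have E := @fubini_tonelli _ _ _ _ _ m1 m2 g mg g0.
rewrite [LHS]integral_mkcond [RHS]integral_mkcond.
transitivity (\int[m1]_x \int[m2]_y g (x, y))%E.
  apply: eq_integral => x _; rewrite patchE; case: ifPn => xD.
    rewrite integral_mkcond; apply: eq_integral => y _.
    by rewrite /g !patchE in_setX/= xD.
  rewrite integral0_eq// => y _.
  by rewrite /g patchE in_setX/= (negbTE xD).
rewrite E; apply: eq_integral => y _; rewrite patchE; case: ifPn => yD.
  rewrite [RHS]integral_mkcond; apply: eq_integral => x _.
  by rewrite /g !patchE in_setX/= yD andbT.
rewrite integral0_eq// => x _.
by rewrite /g patchE in_setX/= (negbTE yD) andbF.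
Qed.

Lemma fubini_tonelli1_on d1 d2 (T1 : measurableType d1) (T2 : measurableType d2)
    (m1 : {sigma_finite_measure set T1 -> \bar R})
    (m2 : {sigma_finite_measure set T2 -> \bar R})
    (D1 : set T1) (D2 : set T2) (f : T1 * T2 -> \bar R) :
  measurable D1 -> measurable D2 -> measurable_fun setT f ->
  (forall x, 0 <= f x)%E ->
  (\int[m1 \x m2]_(p in D1 `*` D2) f p =
   \int[m1]_(x in D1) \int[m2]_(y in D2) f (x, y))%E.
Proof.
move=> mD1 mD2 mf f0.
pose g := f \_ (D1 `*` D2).
have mg : measurable_fun setT g.
  apply/(measurable_restrictT f) => //; first exact: measurableX.
  exact: measurable_funTS.
have g0 x : (0 <= g x)%E by rewrite /g patchE; case: ifP.
rewrite [LHS]integral_mkcond [RHS]integral_mkcond.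
rewrite (@fubini_tonelli1 _ _ _ _ _ m1 m2 g mg g0).
apply: eq_integral => x _; rewrite patchE; case: ifPn => xD.
  rewrite [RHS]integral_mkcond; apply: eq_integral => y _.
  by rewrite /g !patchE in_setX/= xD.
rewrite /fubini_F integral0_eq// => y _.
by rewrite /g patchE in_setX/= (negbTE xD).
Qed.

Lemma measurable_integral_on d1 d2 (T1 : measurableType d1)
    (T2 : measurableType d2)
    (m2 : {sigma_finite_measure set T2 -> \bar R})
    (D2 : set T2) (f : T1 * T2 -> \bar R) :
  measurable D2 -> measurable_fun setT f -> (forall x, 0 <= f x)%E ->
  measurable_fun setT (fun x => \int[m2]_(y in D2) f (x, y))%E.
Proof.
move=> mD2 mf f0.
pose g := f \_ (setT `*` D2).
have mg : measurable_fun setT g.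
  apply/(measurable_restrictT f) => //; first exact: measurableX.
  exact: measurable_funTS.
have g0 x : (0 <= g x)%E by rewrite /g patchE; case: ifP.
have := @measurable_fun_fubini_tonelli_F _ _ _ _ _ m2 g mg g0.
apply: eq_measurable_fun => x _; rewrite [RHS]integral_mkcond.
by apply: eq_integral => y _; rewrite /g !patchE in_setX/= in_setT.
Qed.

(** The image of Lebesgue measure under the affine map, multiplied by [k], gives every interval []a,
    b]] its length, so it is Lebesgue measure by uniqueness. The rest is integration against an
    image measure. *)
Lemma ge0_integral_affine (k d : R) (f : R -> \bar R) : 0 < k ->
  measurable_fun setT f -> (forall x, 0 <= f x)%E ->
  (\int[mu]_x f (k * x + d)%R = (k^-1)%:E * \int[mu]_x f x)%E.
Proof.
move=> k0 mf f0.
pose phi : measurableTypeR R -> measurableTypeR R := fun x : R => k * x + d.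
have mphi : measurable_fun setT phi.
  by apply: measurable_funD => //; exact: measurable_funM.
have kV0 : 0 <= k^-1 by rewrite invr_ge0 ltW.
pose phi' : {mfun _ >-> _} := HB.pack phi (isMeasurableFun.Build _ _ _ _ _ mphi).
have E A : measurable A ->
    mscale (NngNum (ltW k0)) (pushforward mu phi') A = mu A.
  move=> mA; apply/esym/lebesgue_measure_unique => //= _ [[a b]] _ <-.
  rewrite /mscale/= /pushforward/=.
  have -> : phi @^-1` `]a, b] = `](a - d) / k, (b - d) / k]%classic.
    apply/seteqP; split => x /=; rewrite !in_itv/= ltr_pdivrMr// ler_pdivlMr//.
      by rewrite /phi ltrBlDr lerBrDr (mulrC x).
    by rewrite /phi ltrBlDr lerBrDr (mulrC x).
  rewrite !lebesgue_measure_itv/= !lte_fin ltr_pM2r ?invr_gt0// ltrBlDr subrK.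
  case: ifPn => _; last by rewrite mule0.
  rewrite -!EFinD -EFinM; congr EFin; field; exact: lt0r_neq0.
have := @ge0_integral_pushforward _ _ _ _ R phi mphi mu setT f measurableT.
rewrite preimage_setT => /(_ mf) => <-; last by move=> ? _; exact: f0.
transitivity ((k^-1)%:E * (k%:E * \int[pushforward mu phi]_y f y))%E.
  by rewrite muleA -EFinM mulVf ?mul1e// lt0r_neq0.
congr (_ * _)%E.
rewrite -(@ge0_integral_mscale _ _ R (pushforward mu phi') setT measurableT
  (NngNum (ltW k0)))//.
by apply: eq_measure_integral => A mA _; exact: E.
Qed.

Lemma ge0_integral_scale (k : R) (f : R -> \bar R) : 0 < k ->
  measurable_fun setT f -> (forall x, 0 <= f x)%E ->
  (\int[mu]_(x in `]0%R, +oo[) f (k * x)%R =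
   (k^-1)%:E * \int[mu]_(x in `]0%R, +oo[) f x)%E.
Proof.
move=> k0 mf f0.
rewrite [LHS]integral_mkcond [in RHS]integral_mkcond.
rewrite -(@ge0_integral_affine k 0)//; last 2 first.
- by apply/(measurable_restrictT f) => //; exact: measurable_funTS.
- by move=> x; rewrite patchE; case: ifP.
apply: eq_integral => x _; rewrite !patchE addr0.
by rewrite !mem_setE !in_itv/= !andbT pmulr_rgt0.
Qed.

Lemma ge0_integral_shift (d : R) (f : R -> \bar R) :
  measurable_fun setT f -> (forall x, 0 <= f x)%E ->
  (\int[mu]_(x in `]0%R, +oo[) f (x + d)%R =
   \int[mu]_(x in `]d, +oo[) f x)%E.
Proof.
move=> mf f0.
rewrite [LHS]integral_mkcond [in RHS]integral_mkcond.
transitivity (\int[mu]_x (f \_ `]d, +oo[) (1 * x + d)%R)%E; last first.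
  rewrite (@ge0_integral_affine 1 d)//; first by rewrite invr1 mul1e.
    by apply/(measurable_restrictT f) => //; exact: measurable_funTS.
  by move=> x; rewrite patchE; case: ifP.
apply: eq_integral => x _; rewrite !patchE mul1r.
by rewrite !mem_setE !in_itv/= !andbT ltrDr.
Qed.

End integration_tools.

(** * Laplace transforms determine distribution functions *)

Section laplace_uniqueness.
Context {R : realType}.

Lemma bernoulli_ineq (x : R) (m : nat) : 0 <= x <= 1 ->
  1 - m%:R * x <= (1 - x) ^+ m <= 1.
Proof.
move=> /andP[x0 x1]; elim: m => [|m /andP[IH1 IH2]].
  by rewrite expr0 mul0r subr0 lexx.
have y0 : 0 <= 1 - x by rewrite subr_ge0.
rewrite exprS; apply/andP; split; last first.
  by rewrite mulr_ile1 ?exprn_ge0// gerBl.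
apply: (@le_trans _ _ ((1 - x) * (1 - m%:R * x))); last by rewrite ler_wpM2l.
rewrite -natr1; have := ler0n R m; nra.
Qed.

(** The logarithm of [M n * expR (- (rate theta n * s))] is [n^2 * ln 2 * (1 - s / theta) - n * s /
    theta]. For [s < theta] the quadratic term wins; at [s = theta] only the linear one is left,
    which is due to the summand 1 in [rate]. The exponent has to be a natural number for the power
    to expand into finitely many exponentials. *)
Let M (n : nat) : nat := 2 ^ (n * n).
Let rate (theta : R) (n : nat) : R := n%:R * (n%:R * ln 2 + 1) / theta.
Let step (theta : R) (n : nat) (s : R) : R :=
  (1 - expR (- (rate theta n * s))) ^+ M n.

Let rate_ge0 theta n : 0 < theta -> 0 <= rate theta n.
Proof.
move=> t0; rewrite divr_ge0 ?(ltW t0)// mulr_ge0// addr_ge0// mulr_ge0//.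
by rewrite ln_ge0// ler1n.
Qed.

Let Mexp theta n s :
  (M n)%:R * expR (- (rate theta n * s)) =
  expR (n%:R * n%:R * ln 2 - rate theta n * s) :> R.
Proof.
rewrite expRD; congr (_ * _).
rewrite /M natrX -natrM -[X in _ = expR (_ * X)]mul1r mul1r mulrC.
by rewrite expRM_natr lnK// posrE.
Qed.

Let exp01 theta n s : 0 < theta -> 0 <= s ->
  0 <= expR (- (rate theta n * s)) <= 1.
Proof.
by move=> t0 s0; rewrite expR_ge0 -expR0 ler_expR oppr_le0 mulr_ge0// rate_ge0.
Qed.

Let step01 theta n s : 0 < theta -> 0 <= s -> 0 <= step theta n s <= 1.
Proof.
move=> t0 s0; have e01 := exp01 n t0 s0.
have /andP[_ ->] := bernoulli_ineq (M n) e01.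
by rewrite exprn_ge0// subr_ge0; case/andP: e01.
Qed.

(* The rate is chosen so that [M n * expR (- rate theta n * s)] tends to 0 for
   [theta <= s], included at [s = theta], and to +oo for [s < theta]. *)
Let step_cvg theta s : 0 < theta -> 0 <= s ->
  step theta n s @[n --> \oo] --> ((theta <= s)%R%:R : R).
Proof.
move=> t0 s0; have [ts|st] := leP theta s; rewrite /=.
- have c1 : (1 - @harmonic R n) @[n --> \oo] --> (1 : R).
    by rewrite -[X in _ --> X]subr0; apply: cvgB; [exact: cvg_cst|exact: cvg_harmonic].
  apply: (squeeze_cvgr _ c1); last exact: cvg_cst.
  apply: nearW => n.
  have /andP[l1 ->] := bernoulli_ineq (M n) (exp01 n t0 s0).
  rewrite andbT; apply: le_trans l1; rewrite lerD2l lerN2 Mexp /harmonic/=.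
  have -> : (n.+1%:R : R)^-1 = (1 + n%:R)^-1 by rewrite nat1r.
  apply: (@le_trans _ _ (expR (- n%:R))); last first.
    by rewrite expRN lef_pV2 ?posrE ?expR_gt0 ?ltr_pwDl// expR_ge1Dx.
  rewrite ler_expR lerBlDr.
  have : rate theta n * theta <= rate theta n * s.
    by rewrite ler_wpM2l// rate_ge0.
  rewrite {1}/rate divfK ?lt0r_neq0//; lra.
- have c0 := @cvg_harmonic R.
  apply: (squeeze_cvgr _ (cvg_cst 0) c0).
  have d0 : 0 < ln 2 * (1 - s / theta).
    rewrite mulr_gt0//; first by rewrite ln_gt0// ltr1n.
    by rewrite subr_gt0 ltr_pdivrMr// mul1r.
  near=> n; have /andP[-> _]/= := step01 n t0 s0.
  rewrite -nat1r.
  (* With [x] the exponential, the power is at most [expR (- (M * x))], so [n <= M * x] suffices: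
     then [1 + n <= expR n <= expR (M * x)]. *)
  apply: (@le_trans _ _ (expR (- ((M n)%:R * expR (- (rate theta n * s)))))).
    rewrite -mulrN mulrC expRM_natr lerXn2r ?nnegrE ?expR_ge0//.
      by rewrite subr_ge0; have /andP[] := exp01 n t0 s0.
    exact: expR_ge1Dx.
  rewrite expRN lef_pV2 ?posrE ?expR_gt0 ?ltr_pwDl//.
  apply: (@le_trans _ _ (expR n%:R)); first exact: expR_ge1Dx.
  rewrite ler_expR Mexp; apply: (@le_trans _ _ (expR n%:R)).
    by apply: le_trans (expR_ge1Dx _); lra.
  (* As [s < theta], the second factor tends to +oo with [n]; it only has to exceed 1. *)
  have -> : n%:R * n%:R * ln 2 - rate theta n * s =
      n%:R * (n%:R * (ln 2 * (1 - s / theta)) - s / theta) by rewrite /rate; lra.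
  rewrite ler_expR ler_peMr// lerBrDr -ler_pdivrMr//.
  by near: n; exact: nbhs_infty_ger.
Unshelve. all: by end_near. Qed.

Section one_space.
Context d (T : measurableType d) (m : {measure set T -> \bar R}).
Variables (D : set T) (w X : T -> R).
Hypotheses (mD : measurable D) (mw : measurable_fun D w)
  (mX : measurable_fun D X) (w0 : forall x, D x -> 0 <= w x)
  (X0 : forall x, D x -> 0 <= X x)
  (intw : (\int[m]_(x in D) (w x)%:E < +oo)%E).

Let integrable_weight : m.-integrable D (EFin \o w).
Proof.
apply: ge0_integrable => //; exact/measurable_EFinP.
Qed.

Lemma integrable_weighted (f : T -> R) : measurable_fun D f ->
  (forall x, D x -> 0 <= f x <= 1) ->
  m.-integrable D (fun x => (w x * f x)%:E).
Proof.
move=> mf f01; apply: le_integrable integrable_weight => //.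
  by apply/measurable_EFinP; exact: measurable_funM.
move=> x Dx /=; have /andP[f0 f1] := f01 x Dx.
by rewrite lee_fin !ger0_norm ?mulr_ge0 ?w0// ler_piMr// w0.
Qed.

Lemma measurable_expRN (l : R) : measurable_fun D (fun x => expR (- (l * X x))).
Proof.
apply: measurableT_comp => //; apply: measurableT_comp => //.
exact: measurable_funM.
Qed.

Lemma expRN_le1 (l : R) x : 0 <= l -> D x -> 0 <= expR (- (l * X x)) <= 1.
Proof.
move=> l0 Dx.
by rewrite expR_ge0 -expR0 ler_expR oppr_le0 mulr_ge0// X0.
Qed.

Lemma cvg_integral_step theta : 0 < theta ->
  (\int[m]_(x in D) (w x * step theta n (X x))%:E @[n --> \oo] -->
   \int[m]_(x in D) (w x * (theta <= X x)%R%:R)%:E)%E.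
Proof.
move=> t0.
have mstep n : measurable_fun D (fun x => step theta n (X x)).
  apply: measurable_funX; apply: measurable_funB => //.
  exact: measurable_expRN.
have [] := @dominated_convergence _ _ _ m D mD
  (fun n x => (w x * step theta n (X x))%:E)
  (fun x => (w x * (theta <= X x)%R%:R)%:E) (EFin \o w) => //.
- by move=> n; apply/measurable_EFinP; exact: measurable_funM.
- apply/measurable_EFinP; apply: measurable_funM => //.
  exact: measurable_leR.
- apply: aeW => x Dx; apply: cvg_EFin; first exact: nearW.
  by apply: cvgM; [exact: cvg_cst|apply: step_cvg => //; exact: X0].
- apply: aeW => x n Dx /=; have /andP[s0 s1] := step01 n t0 (X0 Dx).
  by rewrite lee_fin ger0_norm ?mulr_ge0 ?w0// ler_piMr// w0.
Qed.

(** The powers converge to the indicator of [theta <= X], while distribution functions are taken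
    here with a strict inequality; finite total mass allows passing to the complement. *)
Lemma integral_ltE theta : (\int[m]_(x in D) (w x * (X x < theta)%R%:R)%:E =
  \int[m]_(x in D) (w x)%:E - \int[m]_(x in D) (w x * (theta <= X x)%R%:R)%:E)%E.
Proof.
rewrite -integralB//=; last first.
  apply: integrable_weighted; first exact: measurable_leR.
  by move=> x _; rewrite ler0n lern1 leq_b1.
apply: eq_integral => x _; rewrite -EFinB; congr EFin.
by case: leP => _; rewrite /=; ring.
Qed.

(** The binomial expansion of the power, one factor at a time: the recurrence in [k] lets equality
    of Laplace transforms, the case [k = 0], propagate to every power. *)
Definition mixed_moment (l mu : R) (k : nat) : \bar R :=
  \int[m]_(x in D)
    (w x * (expR (- (l * X x)) * (1 - expR (- (mu * X x))) ^+ k))%:E.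

Lemma mixed_momentS l mu k : 0 <= l -> 0 <= mu ->
  (mixed_moment l mu k.+1 = mixed_moment l mu k - mixed_moment (l + mu)%R mu k)%E.
Proof.
move=> l0 mu0.
have ig l' : 0 <= l' -> m.-integrable D (fun x =>
    (w x * (expR (- (l' * X x)) * (1 - expR (- (mu * X x))) ^+ k))%:E).
  move=> l'0; apply: integrable_weighted => //.
    apply: measurable_funM; first exact: measurable_expRN.
    apply: measurable_funX; apply: measurable_funB => //.
    exact: measurable_expRN.
  move=> x Dx; have /andP[a0 a1] := expRN_le1 l'0 Dx.
  have e01 := expRN_le1 mu0 Dx; have /andP[b0 b1] := e01.
  have /andP[_ c1] := bernoulli_ineq k e01.
  have c0 : 0 <= (1 - expR (- (mu * X x))) ^+ k by rewrite exprn_ge0// subr_ge0.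
  by rewrite mulr_ge0// mulr_ile1.
rewrite /mixed_moment -integralB//; [|exact: ig|by apply: ig; exact: addr_ge0].
apply: eq_integral => x _; rewrite -EFinB; congr EFin.
by rewrite mulrDl opprD expRD exprS; ring.
Qed.

End one_space.

(** The weights allow a measure to be given by a density against Lebesgue measure on one side and by
    a random variable on a probability space, or on a product space, on the other. *)
Theorem laplace_unique d1 (T1 : measurableType d1) d2 (T2 : measurableType d2)
    (m1 : {measure set T1 -> \bar R}) (m2 : {measure set T2 -> \bar R})
    (D1 : set T1) (D2 : set T2) (w1 X1 : T1 -> R) (w2 X2 : T2 -> R) :
  measurable D1 -> measurable D2 ->
  measurable_fun D1 w1 -> measurable_fun D2 w2 ->
  measurable_fun D1 X1 -> measurable_fun D2 X2 ->
  (forall x, D1 x -> 0 <= w1 x) -> (forall x, D2 x -> 0 <= w2 x) ->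
  (forall x, D1 x -> 0 <= X1 x) -> (forall x, D2 x -> 0 <= X2 x) ->
  (\int[m1]_(x in D1) (w1 x)%:E < +oo)%E ->
  (forall l, 0 <= l ->
    (\int[m1]_(x in D1) (w1 x * expR (- (l * X1 x)))%:E =
     \int[m2]_(x in D2) (w2 x * expR (- (l * X2 x)))%:E)%E) ->
  forall theta, 0 < theta ->
    (\int[m1]_(x in D1) (w1 x * (X1 x < theta)%R%:R)%:E =
     \int[m2]_(x in D2) (w2 x * (X2 x < theta)%R%:R)%:E)%E.
Proof.
move=> mD1 mD2 mw1 mw2 mX1 mX2 w10 w20 X10 X20 int1 L theta t0.
(* At [l = 0] the transforms are the total masses, so the second one is finite too. *)
have E0 : (\int[m1]_(x in D1) (w1 x)%:E = \int[m2]_(x in D2) (w2 x)%:E)%E.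
  have := L 0 (lexx 0).
  under eq_integral do rewrite mul0r oppr0 expR0 mulr1.
  by under [in RHS]eq_integral do rewrite mul0r oppr0 expR0 mulr1.
have int2 : (\int[m2]_(x in D2) (w2 x)%:E < +oo)%E by rewrite -E0.
rewrite !integral_ltE// E0; congr (_ - _)%E.
(* [l] stays universally quantified in the induction, since the recurrence moves it to [l + mu]. *)
have EP mu k : 0 <= mu -> forall l, 0 <= l ->
    mixed_moment m1 D1 w1 X1 l mu k = mixed_moment m2 D2 w2 X2 l mu k.
  move=> mu0; elim: k => [l l0|k IH l l0].
    rewrite /mixed_moment; under eq_integral do rewrite expr0 mulr1.
    under [in RHS]eq_integral do rewrite expr0 mulr1.
    exact: L.
  by rewrite !mixed_momentS// !IH// addr_ge0.
have c1 := cvg_integral_step mD1 mw1 mX1 w10 X10 int1 t0.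
have c2 := cvg_integral_step mD2 mw2 mX2 w20 X20 int2 t0.
apply: (cvg_unique _ c1); first exact: ereal_hausdorff.
apply: cvg_trans c2; apply: near_eq_cvg; apply: nearW => n.
have := EP (rate theta n) (M n) (rate_ge0 n t0) 0 (lexx 0).
rewrite /mixed_moment; under eq_integral do rewrite mul0r oppr0 expR0 mul1r.
by under [in RHS]eq_integral do rewrite mul0r oppr0 expR0 mul1r.
Qed.

End laplace_uniqueness.

(** * Integrals of exponentials and powers *)

Section elementary_integrals.
Context {R : realType}.
Local Notation mu := (@lebesgue_measure R).

Lemma integral_indic_gt (s : R) (f : R -> R) : 0 <= s ->
  (\int[mu]_(z in `]0%R, +oo[) (f z * (s < z)%R%:R)%:E =
   \int[mu]_(z in `]s, +oo[) (f z)%:E)%E.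
Proof.
move=> s0; rewrite [LHS]integral_mkcond [RHS]integral_mkcond.
apply: eq_integral => z _; rewrite !patchE !mem_setE !in_itv/= !andbT.
by have [sz|zs] := ltP s z; [rewrite (le_lt_trans s0 sz) mulr1|rewrite mulr0 if_same].
Qed.

Lemma integral_indic_lt (t : R) (f : R -> R) :
  (\int[mu]_(z in `]0%R, +oo[) (f z * (z < t)%R%:R)%:E =
   \int[mu]_(z in `]0%R, t[) (f z)%:E)%E.
Proof.
rewrite [LHS]integral_mkcond [RHS]integral_mkcond.
apply: eq_integral => z _; rewrite !patchE !mem_setE !in_itv/= !andbT.
by have [sz|zs] := ltP z t; rewrite ?andbT ?andbF ?mulr1// mulr0 if_same.
Qed.

Lemma integral_indic_ge (s : R) (f : R -> R) : 0 <= s -> measurable_fun setT f ->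
  (\int[mu]_(z in `]0%R, +oo[) (f z * (s <= z)%R%:R)%:E =
   \int[mu]_(z in `]s, +oo[) (f z)%:E)%E.
Proof.
rewrite le_eqVlt => /predU1P[<-|s0] mf.
  by apply: eq_integral => z; rewrite inE/= in_itv/= andbT => /ltW ->; rewrite mulr1.
rewrite integral_itv_obnd_cbnd; last first.
  by apply/measurable_EFinP; exact: measurable_funTS.
rewrite [LHS]integral_mkcond [RHS]integral_mkcond.
apply: eq_integral => z _; rewrite !patchE !mem_setE !in_itv/= !andbT.
have [sz|zs] := leP s z; last by rewrite mulr0 if_same.
by rewrite (lt_le_trans s0 sz) mulr1.
Qed.

Lemma integral_expRN_gt (b s : R) : 0 < b ->
  (\int[mu]_(z in `]s, +oo[) (expR (- (b * z)))%:E = (expR (- (b * s)) / b)%:E)%E.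
Proof.
move=> b0.
pose F : R -> R := fun z => - b^-1 * expR (- b * z).
have dF (x : R) : is_derive x 1 F (expR (- (b * x))).
  have dG : is_derive x 1 (- b \*: (@id R)) (- b).
    by apply: is_derive_eq; rewrite /GRing.scale/= mulr1.
  have dE : is_derive x 1 (expR \o (- b \*: (@id R))) (expR (- b * x) * - b).
    exact: is_derive1_comp.
  have := @is_deriveZ _ _ _ _ (- b^-1) _ _ _ dE.
  rewrite /GRing.scale/= mulrCA mulrNN mulVf ?lt0r_neq0// mulr1 mulNr.
  exact.
have dFx (x : R) : derivable F x 1 by apply: ex_derive.
have cF (x : R) : F z @[z --> x] --> F x.
  by apply: differentiable_continuous; exact/derivable1_diffP.
have ce (x : R) : expR (- (b * z)) @[z --> x] --> expR (- (b * x)).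
  apply: (@continuous_comp _ _ _ (fun z => - (b * z)) expR);
    last exact: continuous_expR.
  apply: cvgN; apply: cvgM; [exact: cvg_cst|exact: cvg_id].
rewrite integral_itv_obnd_cbnd; last first.
  apply/measurable_EFinP; apply: measurableT_comp => //.
  by apply: measurableT_comp => //; exact: measurable_funM.
rewrite (@ge0_continuous_FTC2y _ _ F _ 0)//.
- by rewrite sub0e -EFinN /F mulNr opprK mulrC mulNr.
- by apply: continuous_subspaceT => x; exact: ce.
- rewrite -(mulr0 (- b^-1)); apply: cvgM; first exact: cvg_cst.
  rewrite (_ : (fun z => _) = (fun z => expR (- z)) \o (fun z => b * z)); last first.
    by apply/funext => z /=; rewrite mulNr.
  apply: (@cvg_comp _ _ _ _ _ _ (pinfty_nbhs R)); last exact: cvgr_expR.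
  exact: gt0_cvgMry.
- exact/cvg_at_right_filter/cF.
- by move=> x _; rewrite derive1E; apply: derive_val.
Qed.

(** For [y < 1] the integrand is unbounded at 0, so the fundamental theorem of calculus is applied
    on [[z / (n + 1), z]] and followed by monotone convergence. *)
Lemma integral_powR0 (y z : R) : 0 < y -> 0 < z ->
  (\int[mu]_(s in `]0%R, z]) (s `^ (y - 1))%:E = (z `^ y / y)%:E)%E.
Proof.
move=> y0 z0.
pose F (n : nat) : set R := `[z / n.+1%:R, z]%classic.
have zn0 n : 0 < z / n.+1%:R by rewrite divr_gt0.
have zn_lt n : z / n.+2%:R < z.
  by rewrite ltr_pdivrMr// ltr_pMr// ltr1n.
have UF : \bigcup_i F i = `]0, z]%classic.
  apply/seteqP; split => s /=.
    by move=> [n _]; rewrite /F/= !in_itv/= => /andP[/(lt_le_trans (zn0 n)) -> ->].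
  rewrite in_itv/= => /andP[s0 sz].
  exists (Num.truncn (z / s)) => //; rewrite /F/= in_itv/= sz andbT.
  rewrite ler_pdivrMr// mulrC -ler_pdivrMr//; apply/ltW.
  by rewrite truncnS_gt.
have mp : measurable_fun setT (fun s : R => (s `^ (y - 1))%:E).
  by apply/measurable_EFinP; exact: measurable_powR.
have H : (\int[mu]_(s in F i) (s `^ (y - 1))%:E)%E @[i --> \oo] -->
    (\int[mu]_(s in `]0%R, z]) (s `^ (y - 1))%:E)%E.
  rewrite -UF; apply: ge0_nondecreasing_set_cvg_integral.
  - move=> n m nm; rewrite subsetEset => s; rewrite /F/= !in_itv/= => /andP[+ ->].
    rewrite andbT; apply: le_trans; rewrite ler_pM2l// lef_pV2 ?posrE//.
    by rewrite ler_nat ltnS.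
  - by move=> i; exact: measurable_itv.
  - by move=> i; exact: measurable_funTS.
  - by move=> i x _; rewrite lee_fin powR_ge0.
suff H' : (\int[mu]_(s in F i) (s `^ (y - 1))%:E)%E @[i --> \oo] -->
    (z `^ y / y)%:E by exact: (cvg_unique (@ereal_hausdorff R) H H').
(* [F 0] is the single point [z]; from index 1 on the interval is nondegenerate. *)
rewrite -cvg_shiftS.
have E n : (\int[mu]_(s in F n.+1) (s `^ (y - 1))%:E)%E =
    ((z `^ y - (z / n.+2%:R) `^ y) / y)%:E.
  have pos (x : R) : x \in `[z / n.+2%:R, z] -> 0 < x.
    by rewrite in_itv/= => /andP[/(lt_le_trans (zn0 n.+1))].
  have dG (x : R) : 0 < x -> is_derive x 1 (fun s => y^-1 * s `^ y) (x `^ (y - 1)).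
    move=> x0; have := @is_deriveZ _ _ _ _ (y^-1) _ _ _ (is_derive1_powR y x0).
    by rewrite /GRing.scale/= mulrA mulVf ?lt0r_neq0// mul1r.
  have cG (x : R) : 0 < x -> (fun s => y^-1 * s `^ y) s @[s --> x] --> y^-1 * x `^ y.
    move=> x0.
    suff : {for x, continuous (fun s : R => y^-1 * s `^ y)} by [].
    apply: differentiable_continuous; apply/derivable1_diffP.
    by apply: ex_derive; exact: dG.
  rewrite (@continuous_FTC2 _ _ (fun s => y^-1 * s `^ y))//.
  - by rewrite -EFinB; congr EFin; rewrite mulrBl ![_ / y]mulrC.
  - apply: derivable_within_continuous => x /pos x0.
    exact: (@ex_derive _ _ _ _ _ _ _ (is_derive1_powR _ x0)).
  - split.
    + move=> x xin; have x0 : 0 < x by apply: pos; apply: subset_itv_oo_cc xin.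
      by apply: ex_derive; exact: dG.
    + by apply/cvg_at_right_filter/cG; exact: zn0.
    + by apply/cvg_at_left_filter/cG.
  - move=> x xin; have x0 : 0 < x by apply: pos; apply: subset_itv_oo_cc xin.
    by rewrite derive1E; apply: derive_val; exact: dG.
rewrite (_ : [sequence _]_n = fun n => ((z `^ y - (z / n.+2%:R) `^ y) / y)%:E);
  last first.
  by apply/funext => n /=; rewrite E.
apply: cvg_EFin; first exact: nearW.
rewrite /comp/=; apply: cvgMl; rewrite -[X in _ --> X]subr0; apply: cvgB;
  first exact: cvg_cst.
have /cvg_at_rightP c0 := @powR_cvg0 R y y0.
apply: c0; split => [n|]; first exact: zn0.
rewrite -(mulr0 z); apply: cvgM; first exact: cvg_cst.
by have := @cvg_harmonic R; rewrite -cvg_shiftS.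
Qed.

End elementary_integrals.

(** * Gamma function and gamma distributions *)

Section gamma_integral.
Context {R : realType}.
Local Notation mu := (@lebesgue_measure R).
Local Notation D := (`]0%R, +oo[%classic : set R).

(** The value stays in [\bar R] because finiteness is a consequence of the recurrence in [y], which
    therefore has to be proved before it. *)
Definition gamma_integral (y : R) : \bar R :=
  \int[mu]_(s in D) (expR ((y - 1) * ln s - s))%:E.

Lemma powR_exp_ln (s p : R) : 0 < s -> s `^ p = expR (p * ln s).
Proof. by move=> s0; rewrite /powR gt_eqF. Qed.

Lemma inDP (s : R) : s \in D -> 0 < s.
Proof. by rewrite inE/= in_itv/= andbT. Qed.

Lemma Gamma_integral (y : R) : Gamma y = fine (gamma_integral y).
Proof.
congr fine; apply: eq_integral => s /inDP s0.
by rewrite powR_exp_ln// -expRD.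
Qed.

Lemma gamma_integral_ge0 (y : R) : (0 <= gamma_integral y)%E.
Proof. by apply: integral_ge0 => s _; rewrite lee_fin expR_ge0. Qed.

Lemma measurable_Gamma : measurable_fun setT (@Gamma R).
Proof.
rewrite (_ : @Gamma R = fine \o gamma_integral); last first.
  by apply/funext => y; rewrite Gamma_integral.
apply: (measurableT_comp (@fine_measurable _ setT _)) => //.
apply: (@measurable_integral_on _ _ _ _ _ mu D
  (fun p : R * R => (expR ((p.1 - 1) * ln p.2 - p.2))%:E)) => //.
apply/measurable_EFinP; apply: measurableT_comp => //.
apply: measurable_funB => //; apply: measurable_funM.
  exact: measurable_funB.
exact: measurableT_comp.
Qed.

End gamma_integral.

Ltac measurability := repeat match goal with
  | |- measurable_fun _ (fun _ => EFin _) => apply/measurable_EFinP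
  | |- measurable_fun _ (fun _ => expR _) =>
      apply: (measurableT_comp (@measurable_expR _))
  | |- measurable_fun _ (fun _ => ln _) =>
      apply: (measurableT_comp (@measurable_ln _))
  | |- measurable_fun _ (fun _ => Gamma _) =>
      apply: (measurableT_comp (@measurable_Gamma _))
  | |- measurable_fun _ Gamma => exact: measurable_Gamma
  | |- measurable_fun ?E (+%R ?c) =>
      change (measurable_fun E (fun x => c + x)); apply: measurable_funD
  | |- measurable_fun _ (fun _ => - _) =>
      apply: (measurableT_comp (@oppr_measurable _ setT))
  | |- measurable_fun _ (fun _ => _ + _) => apply: measurable_funD
  | |- measurable_fun _ (fun _ => _ * _) => apply: measurable_funM
  | |- measurable_fun _ (fun _ => _ *+ _) =>
      first [apply: measurable_ltR | apply: measurable_leR]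
  | |- _ => by []
  | |- _ => assumption
  | |- measurable_fun _ (fun _ => fst _) => apply: measurableT_comp
  | |- measurable_fun _ (fun _ => snd _) => apply: measurableT_comp
  end.

Section gamma_function.
Context {R : realType}.
Local Notation mu := (@lebesgue_measure R).
Local Notation D := (`]0%R, +oo[%classic : set R).

(** In place of an integration by parts, [expR (- s)] is written as the integral of [expR (- z)]
    over [z > s]. Exchanging the integrals leaves that of [s ^ (y - 1)] up to [z], which is
    [z ^ y / y]. Tonelli's theorem needs no finiteness. *)
Lemma gamma_integralS (y : R) : 0 < y ->
  (gamma_integral (y + 1) = y%:E * gamma_integral y)%E.
Proof.
move=> y0.
pose f (p : R * R) := (expR ((y - 1) * ln p.1) * (expR (- p.2) * (p.1 < p.2)%R%:R))%:E.
have mf : measurable_fun setT f by rewrite /f; measurability.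
have f0 x : (0 <= f x)%E by rewrite lee_fin !mulr_ge0// expR_ge0.
have E := @fubini_tonelli_on _ _ _ _ _ mu mu D D f (measurable_itv _)
  (measurable_itv _) mf f0.
have E1 : (\int[mu]_(x in D) \int[mu]_(z in D) f (x, z) = gamma_integral y)%E.
  apply: eq_integral => s /inDP s0.
  rewrite /f/=; rewrite ge0_integralMl; [|exact: measurable_itv|exact: expR_ge0
    |by measurability|by move=> ?; rewrite ?mulr_ge0 ?expR_ge0].
  rewrite (integral_indic_gt _ (ltW s0)).
  have := @integral_expRN_gt R 1 s ltr01.
  under eq_integral do rewrite mul1r.
  by move=> ->; rewrite mul1r divr1 -EFinM -expRD.
have mg : measurable_fun setT (fun z => \int[mu]_(s in D) f (s, z))%E.
  apply: (@measurable_integral_on _ _ _ _ _ mu D (fun p : R * R => f (p.2, p.1))) => //.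
  by rewrite /f/=; measurability.
rewrite -E1 E -ge0_integralZl; [|exact: measurable_itv|exact: measurable_funTS
  |by move=> z _; apply: integral_ge0|by rewrite lee_fin ltW].
apply: eq_integral => z /inDP z0.
rewrite /f/=; under eq_integral do rewrite mulrCA.
rewrite ge0_integralMl; [|exact: measurable_itv|exact: expR_ge0|by measurability
  |by move=> ?; rewrite ?mulr_ge0 ?expR_ge0].
rewrite integral_indic_lt.
have -> : (\int[mu]_(s in `]0%R, z[) (expR ((y - 1) * ln s))%:E =
    (z `^ y / y)%:E)%E.
  rewrite -integral_powR0// -integral_itv_bndo_bndc; last first.
    by apply/measurable_EFinP; apply: measurable_funTS; exact: measurable_powR.
  apply: eq_integral => s; rewrite inE/= in_itv/= => /andP[s0 _].
  by rewrite powR_exp_ln.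
rewrite -!EFinM powR_exp_ln// addrK expRD; congr EFin; field.
exact: lt0r_neq0.
Qed.

(** By the recurrence, finiteness at [y] follows from finiteness at [y + 1], where the integrand has
    no singularity at 0. There [ln s <= ln (2 * y) + s / (2 * y)]; with the scale [2 * y] the term
    [y * ln s] uses up only half of the decay of [expR (- s)]. *)
Lemma gamma_integral_lty (y : R) : 0 < y -> (gamma_integral y < +oo)%E.
Proof.
move=> y0.
suff : (gamma_integral (y + 1) < +oo)%E.
  rewrite gamma_integralS//; have := gamma_integral_ge0 y.
  case: gamma_integral => [r _ _|_|//]; first exact: ltry.
  by rewrite gt0_muley ?lte_fin// ltxx.
apply: (@le_lt_trans _ _ (\int[mu]_(s in D) (expR (y * ln (2 * y)) * expR (-
  (2^-1 * s)))%:E)%E).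
  apply: ge0_le_integral => //.
  - by apply: measurable_funTS; measurability.
  - by apply: measurable_funTS; measurability.
  move=> s; rewrite /= in_itv/= andbT => s0; rewrite lee_fin -expRD ler_expR addrK.
  have y2 : 0 < 2 * y by rewrite mulr_gt0.
  have : ln (1 + (s / (2 * y) - 1)) <= s / (2 * y) - 1.
    by apply: le_ln1Dx; rewrite ltrBrDr addrC subrr divr_gt0.
  rewrite addrC subrK ln_div ?posrE// => H.
  have : y * ln s <= y * (ln (2 * y) + s / (2 * y)).
    by rewrite ler_pM2l//; lra.
  have -> : y * (ln (2 * y) + s / (2 * y)) = y * ln (2 * y) + 2^-1 * s.
    by field; exact: lt0r_neq0.
  lra.
rewrite ge0_integralMl; [|exact: measurable_itv|exact: expR_ge0|by measurability
  |by move=> ?; rewrite ?mulr_ge0 ?expR_ge0].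
by rewrite integral_expRN_gt ?invr_gt0// -EFinM ltry.
Qed.

Lemma Gamma_fin (y : R) : 0 < y -> (Gamma y)%:E = gamma_integral y.
Proof.
move=> y0; rewrite Gamma_integral fineK// ge0_fin_numE ?gamma_integral_lty//.
exact: gamma_integral_ge0.
Qed.

Lemma GammaS (y : R) : 0 < y -> Gamma (y + 1) = y * Gamma y.
Proof.
move=> y0; apply: EFin_inj.
by rewrite EFinM !Gamma_fin ?gamma_integralS// addr_gt0.
Qed.

Lemma Gamma1 : Gamma 1 = 1 :> R.
Proof.
apply: EFin_inj; rewrite Gamma_fin// /gamma_integral.
have := @integral_expRN_gt R 1 0 ltr01.
rewrite mulr0 oppr0 expR0 divr1 => <-.
by apply: eq_integral => s _; rewrite subrr mul0r sub0r mul1r.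
Qed.

(** For [s > M] the factor [s ^ y] is at least [M ^ y], and [expR (- s)] has integral [expR (- M)]
    there. Leaving [M] free makes [1 / Gamma] decay faster than any prescribed exponential. *)
Lemma Gamma_ge (y M : R) : 0 < y -> 0 < M -> expR (y * ln M - M) <= Gamma (y + 1).
Proof.
move=> y0 M0; rewrite -lee_fin Gamma_fin ?addr_gt0//.
have E : ((expR (y * ln M - M))%:E =
    \int[mu]_(s in D) (expR (y * ln M) * (expR (- s) * (M < s)%R%:R))%:E)%E.
  rewrite ge0_integralMl; [|exact: measurable_itv|exact: expR_ge0
    |by measurability|by move=> ?; rewrite ?mulr_ge0 ?expR_ge0].
  rewrite integral_indic_gt ?ltW//.
  have := @integral_expRN_gt R 1 M ltr01.
  under eq_integral do rewrite mul1r.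
  by move=> ->; rewrite mul1r divr1 -EFinM -expRD.
rewrite E; apply: ge0_le_integral => //.
- by apply: measurable_funTS; measurability.
- by apply: measurable_funTS; measurability.
move=> s; rewrite /= in_itv/= andbT => s0; rewrite lee_fin addrK.
have [Ms|_] := ltP M s; last by rewrite !mulr0 expR_ge0.
by rewrite mulr1 -expRD ler_expR lerD2r ler_pM2l// ler_ln ?posrE// ltW.
Qed.

Lemma Gamma_gt0 (y : R) : 0 < y -> 0 < Gamma y.
Proof.
move=> y0; have := Gamma_ge y0 ltr01; rewrite GammaS// => /(lt_le_trans (expR_gt0 _)).
by rewrite pmulr_rgt0.
Qed.

End gamma_function.

(** * The limit of Gamma at 1 *)

Section gamma_limit.
Context {R : realType}.
Local Notation mu := (@lebesgue_measure R).
Local Notation D := (`]0%R, +oo[%classic : set R).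

Lemma expRM_le (e x : R) : 0 <= e <= 1 -> expR (e * x) <= 1 + expR x.
Proof.
move=> /andP[e0 e1]; have [x0|x0] := leP x 0.
  rewrite (@le_trans _ _ 1)//; first by rewrite -expR0 ler_expR mulr_ge0_le0.
  by rewrite lerDl expR_ge0.
rewrite (@le_trans _ _ (expR x))//; last by rewrite lerDr.
by rewrite ler_expR ler_piMl// ltW.
Qed.

Lemma cvg_expRM_harmonic (x : R) : expR (n.+1%:R^-1 * x) @[n --> \oo] --> (1 : R).
Proof.
rewrite -[X in _ --> X]expR0; apply: continuous_cvg; first exact: continuous_expR.
rewrite -[X in _ --> X](mul0r x); apply: cvgMl; exact: (@cvg_harmonic R).
Qed.

Lemma harmonic_itv n : 0 <= (n.+1%:R^-1 : R) <= 1.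
Proof. by rewrite invr_ge0 ler0n/= invf_le1// ler1n. Qed.

Lemma cvg_Gamma1D : Gamma (n.+1%:R^-1 + 1) @[n --> \oo] --> (1 : R).
Proof.
have Gfin (n : nat) : (Gamma (n.+1%:R^-1 + 1))%:E =
    (\int[mu]_(s in D) (expR (n.+1%:R^-1 * ln s - s))%:E)%E.
  rewrite Gamma_fin; last exact: addr_gt0.
  by rewrite /gamma_integral addrK.
have G1 : 1%E = (\int[mu]_(s in D) (expR (- s))%:E)%E.
  rewrite -(@Gamma1 R) (Gamma_fin ltr01) /gamma_integral.
  by apply: eq_integral => s _; rewrite subrr mul0r sub0r.
suff H : (Gamma (n.+1%:R^-1 + 1))%:E @[n --> \oo] --> (1 : R)%:E.
  exact: (fine_cvg H).
under eq_fun do rewrite Gfin.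
rewrite G1.
(* The third function dominates because [s ^ e <= 1 + s] for [0 <= e <= 1]; its integral is
   [Gamma 1 + Gamma 2]. *)
have [] := @dominated_convergence _ _ _ mu D (measurable_itv _)
  (fun n s => (expR (n.+1%:R^-1 * ln s - s))%:E) (fun s => (expR (- s))%:E)
  (fun s => (expR (- s) + expR (ln s - s))%:E) => //.
- by move=> n; apply: measurable_funTS; measurability.
- by apply: measurable_funTS; measurability.
- apply: aeW => s _; apply: cvg_EFin; first exact: nearW.
  rewrite -[X in _ --> X]mul1r.
  under eq_fun do rewrite expRD.
  by apply: cvgMl; exact: cvg_expRM_harmonic.
- apply: ge0_integrable => //.
  + by apply: measurable_funTS; measurability.
  under eq_integral do rewrite EFinD.
  rewrite ge0_integralD; [|exact: measurable_itv
    |by move=> s _; rewrite lee_fin expR_ge0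
    |by apply: measurable_funTS; measurability
    |by move=> s _; rewrite lee_fin expR_ge0
    |by apply: measurable_funTS; measurability].
  have <- : gamma_integral 2 = (\int[mu]_(s in D) (expR (ln s - s))%:E)%E.
    apply: eq_integral => s _; have -> : 2 - 1 = 1 :> R by ring.
    by rewrite mul1r.
  by rewrite -G1 lte_add_pinfty ?ltry// gamma_integral_lty.
- apply: aeW => s n _ /=; rewrite lee_fin ger0_norm ?expR_ge0//.
  rewrite !expRD -[X in X + _]mul1r -mulrDl ler_wpM2r ?expR_ge0//.
  exact/expRM_le/harmonic_itv.
Qed.

End gamma_limit.

(** * Gamma laws: Laplace transform and convolution *)

Section gamma_density.
Context {R : realType}.
Local Notation mu := (@lebesgue_measure R).
Local Notation D := (`]0%R, +oo[%classic : set R).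
Variable b : R.
Hypothesis b0 : 0 < b.

(* Exponentials of logarithms make this jointly measurable in [y] and [s] on the
   whole plane; it is the gamma density only for [0 < y] and [0 < s]. *)
Definition gamma_pdf (y s : R) : R :=
  expR (y * ln b + (y - 1) * ln s - b * s - ln (Gamma y)).

Definition gamma_cdf (y t : R) : \bar R :=
  \int[mu]_(s in D) (gamma_pdf y s * (s < t)%R%:R)%:E.

Lemma gamma_pdf_ge0 y s : 0 <= gamma_pdf y s.
Proof. exact: expR_ge0. Qed.

(** Substituting [(b + l) * s] for the variable turns the integral into [gamma_integral y], which
    cancels the normalisation and leaves [(b / (b + l)) ^ y]. *)
Lemma gamma_laplace y l : 0 < y -> 0 <= l ->
  (\int[mu]_(s in D) (gamma_pdf y s * expR (- (l * s)))%:E =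
   (expR (- (y * ln (1 + l / b))))%:E)%E.
Proof.
move=> y0 l0; pose k := b + l; have k0 : 0 < k by rewrite ltr_pwDl.
have Gy0 := Gamma_gt0 y0.
transitivity (\int[mu]_(s in D)
    (expR (y * ln b - ln (Gamma y) - (y - 1) * ln k) *
     expR ((y - 1) * ln (k * s) - (k * s)))%:E)%E.
  apply: eq_integral => s /inDP s0; rewrite -!expRD lnM ?posrE//.
  by congr ((expR _)%:E); rewrite /k; ring.
rewrite ge0_integralMl; [|exact: measurable_itv|exact: expR_ge0|by measurability
  |by move=> ?; exact: expR_ge0].
rewrite (ge0_integral_scale (f := fun s => (expR ((y - 1) * ln s - s))%:E));
  [|exact: k0|by measurability|by move=> s; rewrite lee_fin expR_ge0].
rewrite -/(gamma_integral y) -Gamma_fin// -!EFinM; congr EFin.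
rewrite -[X in _ * (_ * X)](lnK Gy0) -[X in X^-1](lnK k0) -expRN -!expRD.
have -> : 1 + l / b = k / b by rewrite /k mulrDl divff ?lt0r_neq0.
by rewrite ln_div ?posrE//; congr expR; ring.
Qed.

Lemma gamma_mass y : 0 < y -> (\int[mu]_(s in D) (gamma_pdf y s)%:E = 1)%E.
Proof.
move=> y0; have := gamma_laplace y0 (lexx 0).
rewrite mul0r addr0 ln1 mulr0 oppr0 expR0 => <-.
by apply: eq_integral => s _; rewrite mul0r oppr0 expR0 mulr1.
Qed.

Lemma gamma_cdf_ge0 y t : (0 <= gamma_cdf y t)%E.
Proof. by apply: integral_ge0 => s _; rewrite lee_fin mulr_ge0 ?gamma_pdf_ge0. Qed.

Lemma gamma_cdf_le1 y t : 0 < y -> (gamma_cdf y t <= 1)%E.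
Proof.
move=> y0; rewrite -(gamma_mass y0); apply: ge0_le_integral.
- exact: measurable_itv.
- by move=> s _; rewrite lee_fin mulr_ge0 ?gamma_pdf_ge0.
- apply: measurable_funTS; rewrite /gamma_pdf; measurability.
- apply: measurable_funTS; rewrite /gamma_pdf; measurability.
- by move=> s _; rewrite lee_fin ler_piMr ?gamma_pdf_ge0// lern1 leq_b1.
Qed.

Lemma measurable_gamma_cdf t : measurable_fun setT (fun y => gamma_cdf y t).
Proof.
apply: (@measurable_integral_on _ _ _ _ _ mu D
  (fun p : R * R => (gamma_pdf p.1 p.2 * (p.2 < t)%R%:R)%:E)).
- exact: measurable_itv.
- by rewrite /gamma_pdf; measurability.
- by move=> p; rewrite lee_fin mulr_ge0 ?gamma_pdf_ge0.
Qed.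

(** Used for a sum of two independent gamma variables, on the product of two half-lines, and for the
    marginals of the subordinator. *)
Lemma laplace_gamma_cdf d (T : measurableType d) (m : {measure set T -> \bar R})
    (E : set T) (w X : T -> R) (y t : R) :
  measurable E -> measurable_fun E w -> measurable_fun E X ->
  (forall x, E x -> 0 <= w x) -> (forall x, E x -> 0 <= X x) ->
  0 < y -> 0 < t ->
  (forall l, 0 <= l -> (\int[m]_(x in E) (w x * expR (- (l * X x)))%:E =
    (expR (- (y * ln (1 + l / b))))%:E)%E) ->
  (\int[m]_(x in E) (w x * (X x < t)%R%:R)%:E = gamma_cdf y t)%E.
Proof.
move=> mE mw mX w0 X0 y0 t0 L; rewrite /gamma_cdf; apply/esym.
apply: (@laplace_unique _ _ _ _ _ mu m D E (gamma_pdf y) id w X) => //.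
- by apply: measurable_funTS; rewrite /gamma_pdf; measurability.
- by move=> s _; exact: gamma_pdf_ge0.
- by move=> s; rewrite /= in_itv/= andbT => /ltW.
- by rewrite gamma_mass// ltry.
- by move=> l l0; rewrite L// gamma_laplace.
Qed.

(** Under the product density [w] the transform of the sum factors by Tonelli's theorem, so the
    exponents [y] and [e] add up and no Beta integral has to be computed. *)
Lemma gamma_convolution y e t : 0 < y -> 0 < e -> 0 < t ->
  (\int[mu]_(s in D) \int[mu]_(z in D)
     (gamma_pdf y s * gamma_pdf e z * (s + z < t)%R%:R)%:E =
   gamma_cdf (y + e) t)%E.
Proof.
move=> y0 e0 t0.
pose w (p : R * R) := gamma_pdf y p.1 * gamma_pdf e p.2.
have w0 p : 0 <= w p by rewrite mulr_ge0 ?gamma_pdf_ge0.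
have mw : measurable_fun setT w.
  by rewrite /w /gamma_pdf; measurability.
rewrite -(@laplace_gamma_cdf _ _ (mu \x mu)%E (D `*` D) w (fun p => p.1 +
  p.2))//; last first.
- move=> l l0; rewrite fubini_tonelli1_on; [|exact: measurable_itv|exact: measurable_itv
    |by measurability|by move=> p; rewrite lee_fin mulr_ge0 ?expR_ge0].
  transitivity (\int[mu]_(s in D) (expR (- (e * ln (1 + l / b))) *
      (gamma_pdf y s * expR (- (l * s))))%:E)%E.
    apply: eq_integral => s _; rewrite mulrC EFinM -gamma_laplace//.
    rewrite -ge0_integralMl; [|exact: measurable_itv| | |].
    + apply: eq_integral => z _; rewrite /w/= mulrDr opprD expRD.
      by rewrite mulrACA.
    + by rewrite mulr_ge0 ?expR_ge0.
    + by rewrite /gamma_pdf; measurability.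
    + by move=> z; rewrite mulr_ge0 ?expR_ge0.
  rewrite ge0_integralMl; [|exact: measurable_itv|exact: expR_ge0| |].
  + by rewrite gamma_laplace// -EFinM -expRD; congr ((expR _)%:E); ring.
  + by rewrite /gamma_pdf; measurability.
  + by move=> z; rewrite mulr_ge0 ?expR_ge0.
- by rewrite addr_gt0.
- by move=> [s z] /= []; rewrite !in_itv/= !andbT => /ltW s0 /ltW z0; rewrite addr_ge0.
- by apply: measurable_funTS; measurability.
- exact: measurable_funTS.
- exact: measurableX.
by rewrite fubini_tonelli1_on; [|exact: measurable_itv|exact: measurable_itv
  |by measurability|by move=> p; rewrite lee_fin mulr_ge0].
Qed.

End gamma_density.

(** * Bounds on gamma densities and the limit of [(1 - G_e) / e] *)

Section exponential_integral.
Context {R : realType}.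
Local Notation mu := (@lebesgue_measure R).
Local Notation D := (`]0%R, +oo[%classic : set R).
Variable b : R.
Hypothesis b0 : 0 < b.
Local Notation gamma_pdf := (gamma_pdf b).

(** A factor [y] is split off; what remains has the limit [expR (- (b * z)) / z] as [y] tends to
    0. *)
Lemma gamma_pdfE (y z : R) : 0 < y -> 0 < z ->
  gamma_pdf y z = y * ((Gamma (y + 1))^-1 * expR (y * ln (b * z) - b * z - ln z)).
Proof.
move=> y0 z0; have G0 := Gamma_gt0 y0; rewrite GammaS// invfM !mulrA divff ?lt0r_neq0//.
rewrite mul1r -[X in X^-1](lnK G0) -expRN -expRD lnM ?posrE//.
by congr expR; ring.
Qed.

Lemma invr_Gamma_le (y M : R) : 0 < y -> 0 < M ->
  (Gamma (y + 1))^-1 <= expR (M - y * ln M).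
Proof.
move=> y0 M0; rewrite -[M - _]opprB expRN lef_pV2 ?posrE ?expR_gt0 ?Gamma_ge//.
by rewrite Gamma_gt0// addr_gt0.
Qed.

(** The lower bound on Gamma is taken at [M = b * S * expR 1], so that
    [(b * s) ^ y / M ^ y <= expR (- y)]. With the factor [y] of the density this gives
    [y * expR (- y)], integrable in [y], while [S] makes the bound locally uniform in [s]. *)
Lemma gamma_pdf_le (y s S : R) : 0 < y -> 0 < s -> s <= S ->
  gamma_pdf y s <= expR (b * S * expR 1) / s * expR (ln y - y).
Proof.
move=> y0 s0 sS; have S0 := lt_le_trans s0 sS.
have M0 : 0 < b * S * expR 1 by rewrite !mulr_gt0 ?expR_gt0.
rewrite gamma_pdfE//.
apply: (@le_trans _ _ (y * (expR (b * S * expR 1 - y * ln (b * S * expR 1)) *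
    expR (y * ln (b * S) - ln s)))).
  rewrite ler_pM2l// ler_pM ?invr_ge0 ?expR_ge0 ?(ltW (Gamma_gt0 _))//.
  - by rewrite addr_gt0.
  - exact: invr_Gamma_le.
  rewrite ler_expR lerD2r lerBlDr.
  apply: (@le_trans _ _ (y * ln (b * S))); last by rewrite lerDl mulr_ge0 ?ltW.
  by rewrite ler_pM2l// ler_ln ?posrE ?mulr_gt0// ler_pM2l.
rewrite lnM ?posrE ?expR_gt0 ?mulr_gt0// expRK.
rewrite -[X in _ / X](lnK s0) -expRN -[X in X * (_ * _) <= _](lnK y0) -!expRD ler_expR.
by rewrite le_eqVlt; apply/orP; left; apply/eqP; ring.
Qed.

(** The function [h] of the overview, that is, the classical exponential integral [E_1] at [b * x].
    For [x <= 0] the integral diverges and [fine] returns 0. *)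
Definition exp_int (x : R) : R :=
  fine (\int[mu]_(z in D) (expR (- (b * z) - ln z) * (x <= z)%R%:R)%:E).

Definition gamma_tail (e x : R) : R :=
  fine (\int[mu]_(z in D) (gamma_pdf e z * (x <= z)%R%:R)%:E).

Lemma exp_int_ge0 x : 0 <= exp_int x.
Proof.
by apply: fine_ge0; apply: integral_ge0 => z _; rewrite lee_fin mulr_ge0 ?expR_ge0.
Qed.

Lemma gamma_tail_ge0 e x : 0 <= gamma_tail e x.
Proof.
by apply: fine_ge0; apply: integral_ge0 => z _; rewrite lee_fin mulr_ge0 ?gamma_pdf_ge0.
Qed.

Lemma measurable_exp_int : measurable_fun setT exp_int.
Proof.
apply: (measurableT_comp (@fine_measurable _ setT _)) => //.
apply: (@measurable_integral_on _ _ _ _ _ mu D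
  (fun p : R * R => (expR (- (b * p.2) - ln p.2) * (p.1 <= p.2)%R%:R)%:E)).
- exact: measurable_itv.
- by measurability.
- by move=> p; rewrite lee_fin mulr_ge0 ?expR_ge0.
Qed.

Lemma measurable_gamma_tail e : measurable_fun setT (gamma_tail e).
Proof.
apply: (measurableT_comp (@fine_measurable _ setT _)) => //.
apply: (@measurable_integral_on _ _ _ _ _ mu D
  (fun p : R * R => (gamma_pdf e p.2 * (p.1 <= p.2)%R%:R)%:E)).
- exact: measurable_itv.
- by rewrite /gamma_pdf; measurability.
- by move=> p; rewrite lee_fin mulr_ge0 ?gamma_pdf_ge0.
Qed.

Lemma exp_int_fin x : 0 < x -> (exp_int x)%:E =
  (\int[mu]_(z in D) (expR (- (b * z) - ln z) * (x <= z)%R%:R)%:E)%E.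
Proof.
move=> x0; rewrite fineK// ge0_fin_numE; last first.
  by apply: integral_ge0 => z _; rewrite lee_fin mulr_ge0 ?expR_ge0.
apply: (@le_lt_trans _ _ (\int[mu]_(z in D) (x^-1 * expR (- (b * z)))%:E)%E).
  apply: ge0_le_integral; [exact: measurable_itv
    |by move=> z _; rewrite lee_fin mulr_ge0 ?expR_ge0
    |by apply: measurable_funTS; measurability
    |by apply: measurable_funTS; measurability|].
  move=> z; rewrite /= in_itv/= andbT => z0; rewrite lee_fin.
  have [xz|_] := leP x z; last by rewrite mulr0 mulr_ge0 ?expR_ge0 ?invr_ge0 ?(ltW x0).
  rewrite mulr1 expRD mulrC expRN lnK ?posrE// ler_wpM2r ?expR_ge0//.
  by rewrite lef_pV2 ?posrE.
rewrite ge0_integralMl; [|exact: measurable_itv|by rewrite invr_ge0 ltW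
  |by measurability|by move=> ?; exact: expR_ge0].
by rewrite integral_expRN_gt// -EFinM ltry.
Qed.

Lemma gamma_tail_fin e x : 0 < e -> (gamma_tail e x)%:E =
  (\int[mu]_(z in D) (gamma_pdf e z * (x <= z)%R%:R)%:E)%E.
Proof.
move=> e0; rewrite fineK// ge0_fin_numE; last first.
  by apply: integral_ge0 => z _; rewrite lee_fin mulr_ge0 ?gamma_pdf_ge0.
apply: (@le_lt_trans _ _ 1%E); last exact: ltry.
rewrite -(gamma_mass b0 e0); apply: ge0_le_integral; [exact: measurable_itv
  |by move=> z _; rewrite lee_fin mulr_ge0 ?gamma_pdf_ge0
  |by apply: measurable_funTS; rewrite /gamma_pdf; measurability
  |by apply: measurable_funTS; rewrite /gamma_pdf; measurability|].
by move=> z _; rewrite lee_fin ler_piMr ?gamma_pdf_ge0// lern1 leq_b1.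
Qed.

(** The lower bound on Gamma at [M = 1] gives [1 / Gamma (e + 1) <= expR 1], and
    [(b * z) ^ e <= 1 + b * z] for [e <= 1]; the bound no longer contains [e]. *)
Let scaled_pdf_le e z : 0 < e <= 1 -> 0 < z ->
  e^-1 * gamma_pdf e z <=
  expR 1 * (expR (- (b * z) - ln z) + b * expR (- (b * z))).
Proof.
move=> /andP[e0 e1] z0; rewrite gamma_pdfE// mulrA mulVf ?lt0r_neq0// mul1r.
have bz0 : 0 < b * z by rewrite mulr_gt0.
apply: ler_pM; [by rewrite invr_ge0 ltW// Gamma_gt0// addr_gt0|exact: expR_ge0| |].
  by have := invr_Gamma_le e0 ltr01; rewrite ln1 mulr0 subr0.
rewrite -addrA expRD.
have : expR (e * ln (b * z)) <= 1 + b * z.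
  by rewrite -[X in 1 + X](lnK bz0); apply: expRM_le; rewrite (ltW e0).
have -> : b * expR (- (b * z)) = b * z * expR (- (b * z) - ln z).
  by rewrite expRD expRN [expR (- ln z)]expRN lnK ?posrE//; field;
    rewrite lt0r_neq0// expR_eq0.
by move=> H; apply: le_trans (ler_wpM2r (expR_ge0 _) H) _; rewrite mulrDl mul1r.
Qed.

Let scaled_tail e x : 0 < e -> (e^-1 * gamma_tail e x)%:E =
  (\int[mu]_(z in D) (e^-1 * gamma_pdf e z * (x <= z)%R%:R)%:E)%E.
Proof.
move=> e0; rewrite EFinM gamma_tail_fin// -ge0_integralMl.
- by apply: eq_integral => z _; rewrite mulrA.
- exact: measurable_itv.
- by rewrite invr_ge0 ltW.
- by rewrite /gamma_pdf; measurability.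
- by move=> z; rewrite mulr_ge0 ?gamma_pdf_ge0.
Qed.

Let dominating x z :=
  expR 1 * ((expR (- (b * z) - ln z) + b * expR (- (b * z))) * (x <= z)%R%:R).

Let dominating_ge0 x z : 0 <= dominating x z.
Proof.
by rewrite !mulr_ge0 ?expR_ge0// addr_ge0 ?expR_ge0// mulr_ge0 ?expR_ge0 ?(ltW b0).
Qed.

Let measurable_dominating x : measurable_fun setT (dominating x).
Proof. by rewrite /dominating; measurability. Qed.

Let integral_dominating x : 0 < x ->
  (\int[mu]_(z in D) (dominating x z)%:E <= (expR 1 * (exp_int x + 1))%:E)%E.
Proof.
move=> x0; rewrite ge0_integralMl; [|exact: measurable_itv|exact: expR_ge0
  |by measurability|]; last first.
  by move=> z; rewrite mulr_ge0// addr_ge0 ?expR_ge0// mulr_ge0 ?expR_ge0 ?(ltW b0).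
rewrite EFinM lee_pmul2l ?lte_fin ?expR_gt0//.
under eq_integral do rewrite mulrDl EFinD.
rewrite ge0_integralD; [|exact: measurable_itv
  |by move=> z _; rewrite lee_fin mulr_ge0 ?expR_ge0
  |by apply: measurable_funTS; measurability
  |by move=> z _; rewrite lee_fin !mulr_ge0 ?expR_ge0 ?(ltW b0)
  |by apply: measurable_funTS; measurability].
rewrite EFinD exp_int_fin// leeD2l//.
apply: (@le_trans _ _ (\int[mu]_(z in D) (b * expR (- (b * z)))%:E)%E).
  apply: ge0_le_integral; [exact: measurable_itv
    |by move=> z _; rewrite lee_fin !mulr_ge0 ?expR_ge0 ?(ltW b0)
    |by apply: measurable_funTS; measurability
    |by apply: measurable_funTS; measurability|].
  by move=> z _; rewrite lee_fin ler_piMr ?lern1 ?leq_b1// mulr_ge0 ?expR_ge0 ?(ltW b0).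
rewrite ge0_integralMl; [|exact: measurable_itv|exact: ltW
  |by measurability|by move=> ?; exact: expR_ge0].
by rewrite integral_expRN_gt// -EFinM mulr0 oppr0 expR0 mul1r divff ?lt0r_neq0.
Qed.

Lemma gamma_tail_le e x : 0 < e <= 1 -> 0 < x ->
  e^-1 * gamma_tail e x <= expR 1 * (exp_int x + 1).
Proof.
move=> e01 x0; have /andP[e0 _] := e01.
rewrite -lee_fin scaled_tail//; apply: le_trans (integral_dominating x0).
apply: ge0_le_integral; [exact: measurable_itv
  |by move=> z _; rewrite lee_fin !mulr_ge0 ?gamma_pdf_ge0// invr_ge0 ltW
  |by apply: measurable_funTS; rewrite /gamma_pdf; measurability
  |by apply/measurable_EFinP; apply: measurable_funTS; exact: measurable_dominating|].
move=> z; rewrite /= in_itv/= andbT => z0; rewrite lee_fin /dominating mulrA.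
by rewrite ler_wpM2r// scaled_pdf_le.
Qed.

(** By [gamma_pdfE] the scaled density is [(b * z) ^ e / Gamma (e + 1)] times the integrand of
    [exp_int], and the first factor tends to 1. *)
Lemma cvg_gamma_tail x : 0 < x ->
  n.+1%:R^-1^-1 * gamma_tail n.+1%:R^-1 x @[n --> \oo] --> exp_int x.
Proof.
move=> x0.
have e0 n : 0 < (n.+1%:R^-1 : R) by rewrite invr_gt0.
suff H : (n.+1%:R^-1^-1 * gamma_tail n.+1%:R^-1 x)%:E @[n --> \oo] --> (exp_int x)%:E.
  exact: (fine_cvg H).
under eq_fun do rewrite scaled_tail//.
rewrite exp_int_fin//.
have [] := @dominated_convergence _ _ _ mu D (measurable_itv _)
  (fun n z => (n.+1%:R^-1^-1 * gamma_pdf n.+1%:R^-1 z * (x <= z)%R%:R)%:E)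
  (fun z => (expR (- (b * z) - ln z) * (x <= z)%R%:R)%:E)
  (fun z => (dominating x z)%:E) => //.
- by move=> n; apply: measurable_funTS; rewrite /gamma_pdf; measurability.
- by apply: measurable_funTS; measurability.
- apply: aeW => z; rewrite /= in_itv/= andbT => z0.
  apply: cvg_EFin; first exact: nearW.
  apply: cvgMl.
  have -> : (fun n => n.+1%:R^-1^-1 * gamma_pdf n.+1%:R^-1 z) =
    (fun n => (Gamma (n.+1%:R^-1 + 1))^-1 * expR (n.+1%:R^-1 * ln (b * z)) *
      expR (- (b * z) - ln z)).
    apply/funext => n; rewrite gamma_pdfE// mulrA mulVf ?lt0r_neq0// mul1r.
    by rewrite -mulrA -expRD addrA.
  have H : (Gamma (n.+1%:R^-1 + 1))^-1 * expR (n.+1%:R^-1 * ln (b * z)) *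
      expR (- (b * z) - ln z) @[n --> \oo] --> 1^-1 * 1 * expR (- (b * z) - ln z).
    apply: cvgMl; apply: cvgM; last exact: cvg_expRM_harmonic.
    by apply: cvgV; [exact: oner_neq0|exact: cvg_Gamma1D].
  by rewrite invr1 !mul1r in H.
- apply: ge0_integrable.
  + by apply/measurable_EFinP; apply: measurable_funTS; exact: measurable_dominating.
  + by move=> z _; rewrite lee_fin.
  + by apply: le_lt_trans (integral_dominating x0) _; exact: ltry.
- apply: aeW => z n; rewrite /= in_itv/= andbT => z0; rewrite lee_fin ger0_norm.
    rewrite /dominating mulrA ler_wpM2r// scaled_pdf_le// e0/=.
    by have /andP[] := @harmonic_itv R n.
  by rewrite !mulr_ge0 ?gamma_pdf_ge0.
Qed.

End exponential_integral.

(** * The resolvent of the Levy tail *)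

Section resolvent.
Context {R : realType}.
Local Notation mu := (@lebesgue_measure R).
Local Notation D := (`]0%R, +oo[%classic : set R).
Variables b kappa : R.
Hypotheses (b0 : 0 < b) (kappa0 : 0 < kappa).
Local Notation gamma_pdf := (gamma_pdf b).
Local Notation gamma_cdf := (gamma_cdf b).
Local Notation gamma_tail := (gamma_tail b).
Local Notation exp_int := (exp_int b).

Definition gcdf (y t : R) : R := fine (gamma_cdf y t).

Lemma gcdf_fin y t : 0 < y -> (gcdf y t)%:E = gamma_cdf y t.
Proof.
move=> y0; rewrite fineK// ge0_fin_numE; last exact: gamma_cdf_ge0.
by apply: le_lt_trans (gamma_cdf_le1 b0 t y0) _; exact: ltry.
Qed.

Lemma gcdf_integrandE x y t : 0 < y ->
  (expR x * gcdf y t)%:E = ((expR x)%:E * gamma_cdf y t)%E.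
Proof. by move=> y0; rewrite EFinM; congr (_ * _)%E; exact: gcdf_fin. Qed.

Lemma gcdf_ge0 y t : 0 <= gcdf y t.
Proof. by apply: fine_ge0; exact: gamma_cdf_ge0. Qed.

Lemma gcdf_le1 y t : 0 < y -> gcdf y t <= 1.
Proof. by move=> y0; rewrite -lee_fin gcdf_fin// gamma_cdf_le1. Qed.

Lemma measurable_gcdf t : measurable_fun setT (gcdf ^~ t).
Proof.
apply: (measurableT_comp (@fine_measurable _ setT _)) => //.
exact: measurable_gamma_cdf.
Qed.

(** The potential density of the gamma process with [a = 1], killed at rate [kappa]. *)
Definition resolvent (s : R) : R :=
  fine (\int[mu]_(y in D) (expR (- (kappa * y)) * gamma_pdf y s)%:E).

Lemma resolvent_ge0 s : 0 <= resolvent s.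
Proof.
by apply: fine_ge0; apply: integral_ge0 => z _;
  rewrite lee_fin mulr_ge0 ?expR_ge0 ?gamma_pdf_ge0.
Qed.

Lemma measurable_resolvent : measurable_fun setT resolvent.
Proof.
apply: (measurableT_comp (@fine_measurable _ setT _)) => //.
apply: (@measurable_integral_on _ _ _ _ _ mu D
  (fun p : R * R => (expR (- (kappa * p.2)) * gamma_pdf p.2 p.1)%:E)).
- exact: measurable_itv.
- by rewrite /gamma_pdf; measurability.
- by move=> p; rewrite lee_fin mulr_ge0 ?expR_ge0 ?gamma_pdf_ge0.
Qed.

Lemma integral_expR_lny (C : R) : 0 <= C ->
  (\int[mu]_(y in D) (C * expR (ln y - y))%:E < +oo)%E.
Proof.
move=> C0; rewrite ge0_integralMl; [|exact: measurable_itv|exact: C0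
  |by measurability|by move=> ?; exact: expR_ge0].
have -> : (\int[mu]_(y in D) (expR (ln y - y))%:E = gamma_integral 2)%E.
  apply: eq_integral => s _; have -> : 2 - 1 = 1 :> R by ring.
  by rewrite mul1r.
have : (0 < 2 :> R) by []; move=> /Gamma_fin <-.
by rewrite -EFinM ltry.
Qed.

Lemma resolvent_integrand_le s S y : 0 < s -> s <= S -> 0 < y ->
  expR (- (kappa * y)) * gamma_pdf y s <=
  expR (b * S * expR 1) / s * expR (ln y - y).
Proof.
move=> s0 sS y0; apply: le_trans (gamma_pdf_le b0 y0 s0 sS).
by rewrite ler_piMl ?gamma_pdf_ge0// -expR0 ler_expR oppr_le0 mulr_ge0 ?(ltW
  kappa0) ?(ltW y0).
Qed.

Lemma resolvent_fin s : 0 < s -> (resolvent s)%:E =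
  (\int[mu]_(y in D) (expR (- (kappa * y)) * gamma_pdf y s)%:E)%E.
Proof.
move=> s0; rewrite fineK// ge0_fin_numE; last first.
  by apply: integral_ge0 => z _; rewrite lee_fin mulr_ge0 ?expR_ge0 ?gamma_pdf_ge0.
have C0 : 0 <= expR (b * s * expR 1) / s by rewrite divr_ge0 ?expR_ge0 ?ltW.
apply: le_lt_trans (integral_expR_lny C0).
apply: ge0_le_integral; [exact: measurable_itv
  |by move=> z _; rewrite lee_fin mulr_ge0 ?expR_ge0 ?gamma_pdf_ge0
  |by apply: measurable_funTS; rewrite /gamma_pdf; measurability
  |by apply: measurable_funTS; measurability|].
move=> y; rewrite /= in_itv/= andbT => y0.
by rewrite lee_fin resolvent_integrand_le.
Qed.

Lemma integral_resolventM (f : R -> R) : measurable_fun setT f ->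
  (forall s, 0 <= f s) ->
  (\int[mu]_(s in D) (resolvent s * f s)%:E =
   \int[mu]_(y in D) ((expR (- (kappa * y)))%:E *
     \int[mu]_(s in D) (gamma_pdf y s * f s)%:E))%E.
Proof.
move=> mf f0.
transitivity (\int[mu]_(s in D) \int[mu]_(y in D)
    (expR (- (kappa * y)) * (gamma_pdf y s * f s))%:E)%E.
  apply: eq_integral => s /inDP s0; rewrite mulrC EFinM resolvent_fin//.
  rewrite -ge0_integralMl.
  - by apply: eq_integral => y _; rewrite [in LHS]mulrC -mulrA.
  - exact: measurable_itv.
  - exact: f0.
  - by rewrite /gamma_pdf; measurability.
  - by move=> y; rewrite mulr_ge0 ?expR_ge0 ?gamma_pdf_ge0.
rewrite (@fubini_tonelli_on _ _ _ _ _ mu mu D D (fun p =>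
  (expR (- (kappa * p.2)) * (gamma_pdf p.2 p.1 * f p.1))%:E)).
- apply: eq_integral => y _ /=; rewrite ge0_integralMl//.
  + by rewrite /gamma_pdf; measurability.
  + by move=> s; rewrite mulr_ge0 ?gamma_pdf_ge0.
- exact: measurable_itv.
- exact: measurable_itv.
- rewrite /gamma_pdf; measurability.
  by apply: (measurableT_comp mf).
- by move=> p; rewrite lee_fin !mulr_ge0 ?expR_ge0 ?gamma_pdf_ge0.
Qed.

(** This is the integral of [r] over []0, t[], with the integrations exchanged. In this form it is
    at most [1 / kappa], and the index [y] can be shifted by [e]. *)
Definition mean_cdf (t : R) : \bar R :=
  \int[mu]_(y in D) (expR (- (kappa * y)) * gcdf y t)%:E.

Lemma measurable_mean_cdf_integrand t :
  measurable_fun setT (fun y => expR (- (kappa * y)) * gcdf y t).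
Proof.
by apply: measurable_funM; [measurability|exact: measurable_gcdf].
Qed.

Lemma mean_cdf_integrand_ge0 t y : 0 <= expR (- (kappa * y)) * gcdf y t.
Proof. by rewrite mulr_ge0 ?gcdf_ge0 ?expR_ge0. Qed.

Lemma mean_cdf_fin t : mean_cdf t \is a fin_num.
Proof.
rewrite ge0_fin_numE; last first.
  by apply: integral_ge0 => y _; rewrite lee_fin mean_cdf_integrand_ge0.
apply: (@le_lt_trans _ _ (\int[mu]_(y in D) (expR (- (kappa * y)))%:E)%E).
  apply: ge0_le_integral; [exact: measurable_itv
    |by move=> z _; rewrite lee_fin mean_cdf_integrand_ge0
    |by apply/measurable_EFinP; apply: measurable_funTS;
      exact: measurable_mean_cdf_integrand
    |by apply: measurable_funTS; measurability|].
  move=> y; rewrite /= in_itv/= andbT => y0.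
  by rewrite lee_fin ler_piMr ?expR_ge0 ?gcdf_le1.
by rewrite integral_expRN_gt// ltry.
Qed.

Lemma integral_resolvent_lt t :
  (\int[mu]_(s in D) (resolvent s * (s < t)%R%:R)%:E = mean_cdf t)%E.
Proof.
rewrite integral_resolventM//; last by measurability.
by apply: eq_integral => y /inDP y0; rewrite EFinM gcdf_fin.
Qed.

(** The indicator is essential: for [t <= s] the tail is taken at a nonpositive point, where it is
    the full mass 1. *)
Definition tail_weight (e t s : R) : R := (s < t)%R%:R * gamma_tail e (t - s).

Lemma tail_weight_ge0 e t s : 0 <= tail_weight e t s.
Proof. by rewrite mulr_ge0 ?gamma_tail_ge0. Qed.

Lemma measurable_tail_weight e t : measurable_fun setT (tail_weight e t).
Proof.
apply: measurable_funM; first by measurability.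
by apply: (measurableT_comp (measurable_gamma_tail b e)); measurability.
Qed.

Lemma gamma_cdf_split y e t : 0 < y -> 0 < e -> 0 < t ->
  (gamma_cdf y t = gamma_cdf (y + e) t +
   \int[mu]_(s in D) (gamma_pdf y s * tail_weight e t s)%:E)%E.
Proof.
move=> y0 e0 t0; rewrite -gamma_convolution//.
have m1 : measurable_fun setT (fun s => \int[mu]_(z in D)
    (gamma_pdf y s * gamma_pdf e z * (s + z < t)%R%:R)%:E)%E.
  apply: (@measurable_integral_on _ _ _ _ _ mu D (fun p : R * R =>
    (gamma_pdf y p.1 * gamma_pdf e p.2 * (p.1 + p.2 < t)%R%:R)%:E)).
  - exact: measurable_itv.
  - by rewrite /gamma_pdf; measurability.
  - by move=> p; rewrite lee_fin !mulr_ge0 ?gamma_pdf_ge0.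
rewrite -ge0_integralD; [|exact: measurable_itv
  |by move=> s _; apply: integral_ge0 => z _; rewrite lee_fin !mulr_ge0 ?gamma_pdf_ge0
  |exact: measurable_funTS
  |by move=> s _; rewrite lee_fin mulr_ge0 ?gamma_pdf_ge0 ?tail_weight_ge0
  |]; last first.
  apply/measurable_EFinP; apply: measurable_funTS; apply: measurable_funM.
    by rewrite /gamma_pdf; measurability.
  exact: measurable_tail_weight.
apply: eq_integral => s _.
have -> : (gamma_pdf y s * tail_weight e t s)%:E = (\int[mu]_(z in D)
    (gamma_pdf y s * (s < t)%R%:R * (gamma_pdf e z * (t - s <= z)%R%:R))%:E)%E.
  rewrite ge0_integralMl; [|exact: measurable_itv
    |by rewrite mulr_ge0 ?gamma_pdf_ge0
    |by rewrite /gamma_pdf; measurability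
    |by move=> z; rewrite mulr_ge0 ?gamma_pdf_ge0].
  by rewrite -gamma_tail_fin// -EFinM /tail_weight mulrA.
(* The mass 1 of [gamma_pdf e] is inserted so that all three terms become integrals over [z], whose
   integrands agree pointwise. *)
have <- : (\int[mu]_(z in D)
    (gamma_pdf y s * (s < t)%R%:R * gamma_pdf e z)%:E =
    (gamma_pdf y s * (s < t)%R%:R)%:E)%E.
  rewrite ge0_integralMl; [|exact: measurable_itv
    |by rewrite mulr_ge0 ?gamma_pdf_ge0
    |by rewrite /gamma_pdf; measurability|by move=> z; exact: gamma_pdf_ge0].
  by rewrite gamma_mass// mule1.
rewrite -ge0_integralD; [|exact: measurable_itv
  |by move=> z _; rewrite lee_fin !mulr_ge0 ?gamma_pdf_ge0
  |by apply: measurable_funTS; rewrite /gamma_pdf; measurability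
  |by move=> z _; rewrite lee_fin !mulr_ge0 ?gamma_pdf_ge0
  |by apply: measurable_funTS; rewrite /gamma_pdf; measurability].
apply: eq_integral => z /inDP z0; rewrite -EFinD; congr EFin.
move: (gamma_pdf y s) (gamma_pdf e z) => p q; rewrite lerBlDl [s + z < t]ltNge.
have [st|ts] := ltP s t; first by case: leP => _; rewrite /=; ring.
by rewrite (le_trans ts)/= ?lerDl ?(ltW z0)//; ring.
Qed.

(** The piece that is lost when [y] is shifted by [e]. Divided by [e] it tends to 1, and this is
    where the constant 1 of the identity comes from. *)
Definition mean_cdf_near0 (e t : R) : \bar R :=
  \int[mu]_(y in `]0, e]) (expR (- (kappa * y)) * gcdf y t)%:E.

Lemma mean_cdf_near0_fin e t : 0 < e -> mean_cdf_near0 e t \is a fin_num.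
Proof.
move=> e0; rewrite ge0_fin_numE; last first.
  by apply: integral_ge0 => y _; rewrite lee_fin mean_cdf_integrand_ge0.
apply: (@le_lt_trans _ _ (mean_cdf t)).
  apply: ge0_subset_integral.
  - exact: measurable_itv.
  - exact: measurable_itv.
  - by apply/measurable_EFinP; apply: measurable_funTS;
    exact: measurable_mean_cdf_integrand.
  - by move=> z _; rewrite lee_fin mean_cdf_integrand_ge0.
  - by move=> z; rewrite /= !in_itv/= => /andP[-> _].
by rewrite ltey_eq mean_cdf_fin.
Qed.

Lemma mean_cdf_shift e t : 0 < e ->
  (\int[mu]_(y in D) (expR (- (kappa * y)) * gcdf (y + e) t)%:E =
   (expR (kappa * e))%:E * (mean_cdf t - mean_cdf_near0 e t))%E.
Proof.
move=> e0.
pose f (y : R) := (expR (- (kappa * (y - e))) * gcdf y t)%:E.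
have -> : (\int[mu]_(y in D) (expR (- (kappa * y)) * gcdf (y + e) t)%:E =
    \int[mu]_(y in D) f (y + e)%R)%E.
  by apply: eq_integral => y _; rewrite /f addrK.
rewrite ge0_integral_shift; last 2 first.
- apply/measurable_EFinP; apply: measurable_funM; first by measurability.
  exact: measurable_gcdf.
- by move=> x; rewrite lee_fin mulr_ge0 ?gcdf_ge0 ?expR_ge0.
have -> : (mean_cdf t - mean_cdf_near0 e t =
    \int[mu]_(y in `]e, +oo[) (expR (- (kappa * y)) * gcdf y t)%:E)%E.
  have -> : (mean_cdf t = mean_cdf_near0 e t +
      \int[mu]_(y in `]e, +oo[) (expR (- (kappa * y)) * gcdf y t)%:E)%E.
    rewrite /mean_cdf (_ : D = `]0, e]%classic `|` `]e, +oo[%classic); last first.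
      apply/seteqP; split => z /=; rewrite !in_itv/= !andbT.
        by move=> z0; case: (leP z e) => ez; [left; rewrite z0|right].
      by case=> [/andP[]//|]; exact: lt_trans e0.
    apply: ge0_integral_setU.
    - exact: measurable_itv.
    - exact: measurable_itv.
    - by apply/measurable_EFinP; apply: measurable_funTS;
      exact: measurable_mean_cdf_integrand.
    - by move=> z _; rewrite lee_fin mean_cdf_integrand_ge0.
    - apply/disj_set2P; rewrite -subset0 => z /= []; rewrite !in_itv/= andbT.
      by move=> /andP[_ ze] /(le_lt_trans ze); rewrite ltxx.
  by rewrite addeAC subee ?add0e// mean_cdf_near0_fin.
rewrite -ge0_integralMl; [|exact: measurable_itv|exact: expR_ge0
  |exact: measurable_mean_cdf_integrand|exact: mean_cdf_integrand_ge0].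
apply: eq_integral => y _; rewrite /f mulrA -expRD; congr ((expR _ * _)%:E); ring.
Qed.

Lemma mean_cdf_split e t : 0 < e -> 0 < t ->
  (mean_cdf t =
   (expR (kappa * e))%:E * (mean_cdf t - mean_cdf_near0 e t) +
   \int[mu]_(s in D) (resolvent s * tail_weight e t s)%:E)%E.
Proof.
move=> e0 t0; rewrite -mean_cdf_shift// integral_resolventM; last 2 first.
- exact: measurable_tail_weight.
- exact: tail_weight_ge0.
rewrite -ge0_integralD.
- apply: eq_integral => y /inDP y0.
  transitivity ((expR (- (kappa * y)))%:E * gamma_cdf y t)%E.
    exact: gcdf_integrandE.
  rewrite (gamma_cdf_split y0 e0 t0) ge0_muleDr.
  - by congr (_ + _)%E; exact/esym/gcdf_integrandE/addr_gt0.
  - exact: gamma_cdf_ge0.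
  - apply: integral_ge0 => s _.
    by rewrite lee_fin mulr_ge0 ?gamma_pdf_ge0 ?tail_weight_ge0.
- exact: measurable_itv.
- by move=> y _; rewrite lee_fin mulr_ge0 ?gcdf_ge0 ?expR_ge0.
- apply/measurable_EFinP; apply: measurable_funTS; apply: measurable_funM.
    by measurability.
  by apply: (measurableT_comp (measurable_gcdf t)); measurability.
- move=> y _; rewrite mule_ge0 ?lee_fin ?expR_ge0// integral_ge0// => s _.
  by rewrite lee_fin mulr_ge0 ?gamma_pdf_ge0 ?tail_weight_ge0.
- apply: measurable_funTS; apply: emeasurable_funM; first by measurability.
  apply: (@measurable_integral_on _ _ _ _ _ mu D (fun p : R * R =>
    (gamma_pdf p.1 p.2 * tail_weight e t p.2)%:E)).
  + exact: measurable_itv.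
  + apply/measurable_EFinP; apply: measurable_funM.
      by rewrite /gamma_pdf; measurability.
    by apply: (measurableT_comp (measurable_tail_weight e t)); measurability.
  + by move=> p; rewrite lee_fin mulr_ge0 ?gamma_pdf_ge0 ?tail_weight_ge0.
Qed.

End resolvent.

(** * The convolution of [r] with [h + kappa] *)

Section resolvent_identity.
Context {R : realType}.
Local Notation mu := (@lebesgue_measure R).
Local Notation D := (`]0%R, +oo[%classic : set R).
(** The parameter [e] of the overview, run through a sequence as the convergence theorems require;
    it is not the function called h there. *)
Let h (n : nat) : R := n.+1%:R^-1.

Let h_gt0 (n : nat) : 0 < h n. Proof. by rewrite /h invr_gt0. Qed.

(** The slope lies between [k] and [k * expR (k * e)]; both bounds come from [1 + x <= expR x], at
    [k * e] and at [- (k * e)]. *)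
Lemma cvg_expR_slope (k : R) : 0 < k ->
  (n.+1%:R^-1)^-1 * (expR (k * n.+1%:R^-1) - 1) @[n --> \oo] --> k.
Proof.
move=> k0.
have c1 : k * expR (n.+1%:R^-1 * k) @[n --> \oo] --> k.
  rewrite -[X in _ --> X]mulr1; apply: cvgMr; exact: cvg_expRM_harmonic.
apply: (squeeze_cvgr _ (cvg_cst k) c1); apply: nearW => n.
have := h_gt0 n; rewrite /h; move: (n.+1%:R^-1 : R) => e e0.
rewrite mulrC ler_pdivlMr// ler_pdivrMr// (mulrC e k).
have x0 := expR_gt0 (k * e).
apply/andP; split.
  by have := expR_ge1Dx (k * e); lra.
have := expR_ge1Dx (- (k * e)); rewrite expRN => H.
have : (1 + - (k * e)) * expR (k * e) <= 1.
  by rewrite -ler_pdivlMr// div1r.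
move: (expR (k * e)) => E; lra.
Qed.

Variables b kappa : R.
Hypotheses (b0 : 0 < b) (kappa0 : 0 < kappa).
Local Notation gamma_pdf := (gamma_pdf b).
Local Notation gamma_tail := (gamma_tail b).
Local Notation exp_int := (exp_int b).
Local Notation gcdf := (gcdf b).
Local Notation resolvent := (resolvent b kappa).
Local Notation mean_cdf := (mean_cdf b kappa).
Local Notation mean_cdf_near0 := (mean_cdf_near0 b kappa).
Local Notation tail_weight := (tail_weight b).

Lemma gcdf_tail y t : 0 < y -> gcdf y t + gamma_tail y t = 1.
Proof.
move=> y0; apply: EFin_inj; rewrite EFinD (gcdf_fin b0 t y0) gamma_tail_fin//.
rewrite -(gamma_mass b0 y0) -ge0_integralD; [|exact: measurable_itv
  |by move=> s _; rewrite lee_fin mulr_ge0 ?gamma_pdf_ge0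
  |by apply: measurable_funTS; rewrite /gamma_pdf; measurability
  |by move=> s _; rewrite lee_fin mulr_ge0 ?gamma_pdf_ge0
  |by apply: measurable_funTS; rewrite /gamma_pdf; measurability].
apply: eq_integral => s _; rewrite -EFinD -mulrDr; congr EFin.
by case: ltP => _; rewrite ?addr0 ?add0r mulr1.
Qed.

Variable t : R.
Hypothesis t0 : 0 < t.

(** From [1 - expR (- (kappa * y)) * G_y <= (1 - G_y) + kappa * y], where the first summand is
    bounded by [gamma_tail_le]. *)
Let C : R := expR 1 * (exp_int t + 1) + kappa.

Let C_ge0 : 0 <= C.
Proof. by rewrite addr_ge0 ?(ltW kappa0)// mulr_ge0 ?expR_ge0// addr_ge0
  ?exp_int_ge0. Qed.

Lemma mean_cdf_integrand_ge e y : 0 < y -> y <= e -> e <= 1 ->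
  1 <= expR (- (kappa * y)) * gcdf y t + C * e.
Proof.
move=> y0 ye e1.
have g1 : gamma_tail y t <= y * (expR 1 * (exp_int t + 1)).
  rewrite -ler_pdivrMl// gamma_tail_le// y0/=.
  exact: le_trans e1.
have := gcdf_tail t y0; have := gcdf_ge0 b y t; have := gamma_tail_ge0 b y t.
move: (gcdf y t) (gamma_tail y t) g1 => p q g1 q0 p0 pq.
have := expR_ge1Dx (- (kappa * y)); have := expR_ge0 (- (kappa * y)).
have : expR (- (kappa * y)) <= 1.
  by rewrite -expR0 ler_expR oppr_le0 mulr_ge0 ?(ltW kappa0) ?(ltW y0).
have : C * y <= C * e by rewrite ler_wpM2l.
rewrite {1}/C; move: (expR (- (kappa * y))) => w H1 H2 H3 H4.
have : 0 <= (1 - w) * (1 - p) by apply: mulr_ge0; lra.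
lra.
Qed.

Let near0 n := fine (mean_cdf_near0 (h n) t).

(** The middle term is the average over []0, h n]] of an integrand between [1 - C * h n] and 1. *)
Let near0_bounds n : 1 - C * h n <= (h n)^-1 * near0 n <= 1.
Proof.
have e0 := h_gt0 n; have /andP[_ e1] : 0 <= h n <= 1 := @harmonic_itv R n.
have fin := mean_cdf_near0_fin b0 kappa0 t e0.
have m1 : measurable_fun `]0, h n] (fun y => (expR (- (kappa * y)) * gcdf y t)%:E).
  apply/measurable_EFinP; apply: measurable_funTS.
  exact: measurable_mean_cdf_integrand.
have mI : measurable (`]0%R, h n]%classic : set R) by exact: measurable_itv.
have leb : mu (`]0%R, h n]%classic : set R) = (h n)%:E.
  by rewrite lebesgue_measure_itv/= lte_fin e0 sube0.
suff : (1 - C * h n) * h n <= near0 n <= h n.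
  move: (near0 n) e0 => x; move: (h n) => e e0 /andP[xl xu].
  by rewrite [e^-1 * x]mulrC ler_pdivlMr// ler_pdivrMr// mul1r xl.
apply/andP; split.
- have H : ((h n)%:E <= mean_cdf_near0 (h n) t + (C * h n * h n)%:E)%E.
    have -> : (C * h n * h n)%:E = (\int[mu]_(y in `]0%R, h n]) (cst (C * h n)%:E y))%E.
      by rewrite integral_cst//= leb.
    have -> : (h n)%:E = (\int[mu]_(y in `]0%R, h n]) (cst 1%:E y))%E.
      by rewrite integral_cst//= leb mul1e.
    rewrite -ge0_integralD; [|exact: mI
      |by move=> y _; rewrite lee_fin mean_cdf_integrand_ge0|exact: m1
      |by move=> y _; rewrite lee_fin mulr_ge0 ?(ltW e0)
      |exact: measurable_cst].
    apply: ge0_le_integral; [exact: mI|by move=> y _; rewrite lee_fin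
      |exact: measurable_cst
      |by apply: emeasurable_funD => //; exact: measurable_cst|].
    move=> y; rewrite /= in_itv/= => /andP[y0 ye].
    by rewrite -EFinD lee_fin mean_cdf_integrand_ge.
  move: H; rewrite -(fineK fin) -EFinD lee_fin -/(near0 n); lra.
- have H : (mean_cdf_near0 (h n) t <= (h n)%:E)%E.
    have -> : (h n)%:E = (\int[mu]_(y in `]0%R, h n]) (cst 1%:E y))%E.
      by rewrite integral_cst//= leb mul1e.
    apply: ge0_le_integral; [exact: mI
      |by move=> y _; rewrite lee_fin mean_cdf_integrand_ge0
      |exact: m1|exact: measurable_cst|].
    move=> y; rewrite /= in_itv/= => /andP[y0 ye]; rewrite lee_fin.
    rewrite mulr_ile1 ?expR_ge0 ?gcdf_ge0 ?gcdf_le1//.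
    by rewrite -expR0 ler_expR oppr_le0 mulr_ge0 ?(ltW kappa0) ?(ltW y0).
  by move: H; rewrite -(fineK fin) lee_fin.
Qed.

Let cvg_near0 : (h n)^-1 * near0 n @[n --> \oo] --> (1 : R).
Proof.
have c0 : 1 - C * h n @[n --> \oo] --> (1 : R).
  rewrite -[X in _ --> X]subr0 -[X in _ --> _ - X](mulr0 C).
  apply: cvgB; first exact: cvg_cst.
  by apply: cvgMr; exact: (@cvg_harmonic R).
have c1 : (1 : R) @[_ --> \oo] --> (1 : R) by exact: cvg_cst.
apply: (squeeze_cvgr _ c0 c1); apply: nearW => n.
exact: near0_bounds.
Qed.

(** In this section [a] is the integral of [r] up to [t], not the parameter of the subordinator. *)
Let a : R := fine (mean_cdf t).

Let J n := (\int[mu]_(s in D)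
  (resolvent s * ((h n)^-1 * tail_weight (h n) t s))%:E)%E.

Let JE n : J n = ((h n)^-1 * (a - expR (kappa * h n) * (a - near0 n)))%:E.
Proof.
have e0 := h_gt0 n.
have finA := mean_cdf_fin b0 kappa0 t.
have finB := mean_cdf_near0_fin b0 kappa0 t e0.
have -> : J n = (((h n)^-1)%:E *
    \int[mu]_(s in D) (resolvent s * tail_weight (h n) t s)%:E)%E.
  rewrite -ge0_integralMl.
  - by apply: eq_integral => s _; rewrite mulrCA.
  - exact: measurable_itv.
  - by rewrite invr_ge0 ltW.
  - by apply: measurable_funM; [exact: measurable_resolvent
    |exact: measurable_tail_weight].
  - by move=> s; rewrite mulr_ge0 ?resolvent_ge0 ?tail_weight_ge0.
rewrite EFinM; congr (_ * _)%E.
have := mean_cdf_split b0 kappa0 e0 t0.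
rewrite -(fineK finA) -(fineK finB) -/a -/(near0 n).
move=> H; rewrite EFinB {1}H EFinM EFinB addeAC subee ?add0e//.
Qed.

(** Regrouped, [J n] is [expR (kappa * e)] times [near0 / e], which tends to 1, minus the slope of
    [expR (kappa * e)] times [a], which tends to [kappa * a]. *)
Let cvg_J : J n @[n --> \oo] --> (1 - kappa * a)%:E.
Proof.
under eq_fun do rewrite JE.
apply: cvg_EFin; first exact: nearW.
have E n : (h n)^-1 * (a - expR (kappa * h n) * (a - near0 n)) =
    expR (h n * kappa) * ((h n)^-1 * near0 n) -
    (h n)^-1 * (expR (kappa * h n) - 1) * a by rewrite [h n * kappa]mulrC; ring.
have H : expR (h n * kappa) * ((h n)^-1 * near0 n) -
    (h n)^-1 * (expR (kappa * h n) - 1) * a @[n --> \oo] --> 1 * 1 - kappa * a.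
  apply: cvgB.
    by apply: cvgM; [exact: cvg_expRM_harmonic|exact: cvg_near0].
  by apply: cvgMl; exact: cvg_expR_slope.
rewrite mulr1 in H; apply: cvg_trans H; apply: near_eq_cvg; apply: nearW => n.
by rewrite /= E.
Qed.

Let w (s : R) : R := (s < t)%R%:R * exp_int (t - s).

Let w_ge0 s : 0 <= w s.
Proof. by rewrite mulr_ge0 ?exp_int_ge0. Qed.

Let measurable_w : measurable_fun setT w.
Proof.
apply: measurable_funM; first by measurability.
by apply: (measurableT_comp (measurable_exp_int b)); measurability.
Qed.

Let f n s := (resolvent s * ((h n)^-1 * tail_weight (h n) t s))%:E.

Let measurable_f n : measurable_fun setT (f n).
Proof.
apply/measurable_EFinP; apply: measurable_funM; first exact: measurable_resolvent.
by apply: measurable_funM; [exact: measurable_cst|exact: measurable_tail_weight].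
Qed.

Let f_ge0 n s : (0 <= f n s)%E.
Proof.
rewrite lee_fin; apply: mulr_ge0; first exact: resolvent_ge0.
by apply: mulr_ge0; [rewrite invr_ge0 ltW|exact: tail_weight_ge0].
Qed.

Let cvg_f s : f n s @[n --> \oo] --> (resolvent s * w s)%:E.
Proof.
apply: cvg_EFin; first exact: nearW.
apply: cvgMr; rewrite /w /tail_weight.
have [st|ts] := ltP s t; last first.
  have -> : (fun n => (h n)^-1 * (0 * gamma_tail (h n) (t - s))) = (fun=> 0).
    by apply/funext => n; rewrite mul0r mulr0.
  by rewrite mul0r; exact: cvg_cst.
under eq_fun do rewrite mul1r.
by rewrite mul1r; apply: cvg_gamma_tail => //; rewrite subr_gt0.
Qed.

(* Fatou's lemma gives the finiteness that dominated convergence needs below. *)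
Let integral_resolvent_w_le :
  (\int[mu]_(s in D) (resolvent s * w s)%:E <= (1 - kappa * a)%:E)%E.
Proof.
have := @fatou _ _ _ mu D (measurable_itv _) f
  (fun n => measurable_funTS (measurable_f n)) (fun n x _ => f_ge0 n x).
rewrite (cvg_limn_einf_sup cvg_J).1.
have E : (\int[mu]_(s in D) (resolvent s * w s)%:E =
    \int[mu]_(s in D) limn_einf (f ^~ s))%E.
  by apply: eq_integral => s _; rewrite (cvg_limn_einf_sup (@cvg_f s)).1.
by rewrite E.
Qed.

Lemma integral_resolvent_exp_int :
  (\int[mu]_(s in D) (resolvent s * ((s < t)%R%:R * exp_int (t - s)))%:E =
   (1 - kappa * a)%:E)%E.
Proof.
(* By [gamma_tail_le] this dominates [f n] for all [n]. Its first summand is integrable by the Fatou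
   bound, its second because [mean_cdf t] is finite. *)
pose g s := (resolvent s * w s * expR 1 + resolvent s * (s < t)%R%:R * expR 1)%:E.
have mr := measurable_resolvent b kappa.
have m1 : measurable_fun setT (fun s => resolvent s * w s) by exact: measurable_funM.
have m2 : measurable_fun setT (fun s => resolvent s * (s < t)%R%:R).
  by apply: measurable_funM; [exact: mr|measurability].
have p1 s : 0 <= resolvent s * w s by apply: mulr_ge0; [exact: resolvent_ge0|].
have p2 s : 0 <= resolvent s * (s < t)%R%:R by apply: mulr_ge0; [exact: resolvent_ge0|].
have q1 s : 0 <= resolvent s * w s * expR 1 by rewrite mulr_ge0 ?expR_ge0.
have q2 s : 0 <= resolvent s * (s < t)%R%:R * expR 1 by rewrite mulr_ge0 ?expR_ge0.
have ig : mu.-integrable D g.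
  apply: ge0_integrable.
  - by apply: measurable_funTS; apply/measurable_EFinP; apply: measurable_funD;
      apply: measurable_funM.
  - by move=> s _; rewrite lee_fin addr_ge0.
  rewrite /g; under eq_integral do rewrite EFinD.
  rewrite ge0_integralD; [|exact: measurable_itv
    |by move=> s _; rewrite lee_fin
    |by apply: measurable_funTS; apply/measurable_EFinP; apply: measurable_funM
    |by move=> s _; rewrite lee_fin
    |by apply: measurable_funTS; apply/measurable_EFinP; apply: measurable_funM].
  under eq_integral do rewrite mulrC.
  under [X in (_ + X < _)%E]eq_integral do rewrite mulrC.
  rewrite ge0_integralMl; [|exact: measurable_itv|exact: expR_ge0|exact: m1|exact: p1].
  rewrite ge0_integralMl; [|exact: measurable_itv|exact: expR_ge0|exact: m2|exact: p2].
  rewrite integral_resolvent_lt// -(fineK (mean_cdf_fin b0 kappa0 t)) -EFinM.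
  rewrite lte_add_pinfty ?ltry//.
  apply: (@le_lt_trans _ _ ((expR 1)%:E * (1 - kappa * a)%:E)%E).
    by rewrite lee_pmul2l ?lte_fin ?expR_gt0.
  by rewrite -EFinM ltry.
have [] := @dominated_convergence _ _ _ mu D (measurable_itv _) f
  (fun s => (resolvent s * w s)%:E) g.
- by move=> n; apply: measurable_funTS; exact: measurable_f.
- by apply: measurable_funTS; apply/measurable_EFinP; exact: m1.
- by apply: aeW => s _; exact: (@cvg_f s).
- exact: ig.
- apply: aeW => s n _; rewrite gee0_abs ?f_ge0// lee_fin -!mulrA -mulrDr.
  rewrite ler_wpM2l ?resolvent_ge0// /tail_weight /w.
  have [st|ts] := ltP s t; last by rewrite !mul0r mulr0 addr0.
  rewrite !mul1r.
  have e01 : 0 < h n <= 1 by rewrite h_gt0; have /andP[] := @harmonic_itv R n.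
  have x0 : 0 < t - s by rewrite subr_gt0.
  by have := gamma_tail_le b0 e01 x0; rewrite mulrDr mulr1 [expR 1 * _]mulrC.
- move=> _ _ H; exact: (cvg_unique (@ereal_hausdorff R) H cvg_J).
Qed.

Theorem resolvent_convolution :
  (\int[mu]_(s in D)
     (resolvent s * ((s < t)%R%:R * (exp_int (t - s) + kappa)))%:E = 1)%E.
Proof.
have mr := measurable_resolvent b kappa.
have m2 : measurable_fun setT (fun s => resolvent s * (s < t)%R%:R).
  by apply: measurable_funM; [exact: mr|measurability].
have p2 s : 0 <= resolvent s * (s < t)%R%:R by apply: mulr_ge0; [exact: resolvent_ge0|].
transitivity (\int[mu]_(s in D)
    ((resolvent s * w s)%:E + (kappa * (resolvent s * (s < t)%R%:R))%:E))%E.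
  by apply: eq_integral => s _; rewrite -EFinD /w; congr EFin; ring.
rewrite ge0_integralD; [|exact: measurable_itv
  |by move=> s _; rewrite lee_fin; apply: mulr_ge0; [exact: resolvent_ge0|]
  |by apply: measurable_funTS; apply/measurable_EFinP; exact: measurable_funM
  |by move=> s _; rewrite lee_fin mulr_ge0// ltW
  |by apply: measurable_funTS; apply/measurable_EFinP; exact: measurable_funM].
rewrite integral_resolvent_exp_int.
rewrite ge0_integralMl; [|exact: measurable_itv|exact: ltW|exact: m2|exact: p2].
rewrite integral_resolvent_lt// -(fineK (mean_cdf_fin b0 kappa0 t)) -EFinM -EFinD.
by rewrite subrK.
Qed.

End resolvent_identity.

(** * Existence and uniqueness *)

Section solution.
Context {R : realType}.
Local Notation mu := (@lebesgue_measure R).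
Local Notation D := (`]0%R, +oo[%classic : set R).

Section resolvent_primitive.
Variables b kappa : R.
Hypotheses (b0 : 0 < b) (kappa0 : 0 < kappa).
Local Notation gamma_pdf := (gamma_pdf b).
Local Notation resolvent := (resolvent b kappa).
Local Notation mean_cdf := (mean_cdf b kappa).

Lemma continuous_gamma_pdf (y s : R) : 0 < s -> gamma_pdf y z @[z --> s] -->
  gamma_pdf y s.
Proof.
move=> s0; apply: (@continuous_comp _ _ _
  (fun z => y * ln b + (y - 1) * ln z - b * z - ln (Gamma y)) expR);
  last exact: continuous_expR.
apply: cvgB; last exact: cvg_cst.
apply: cvgB; last by apply: cvgMr; exact: cvg_id.
apply: cvgD; first exact: cvg_cst.
by apply: cvgMr; exact: continuous_ln.
Qed.

(** Continuity makes the primitive of [r] differentiable at every positive time with derivative [r],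
    not merely almost everywhere. *)
Lemma continuous_resolvent (s : R) : 0 < s -> {for s, continuous resolvent}.
Proof.
move=> s0.
(* For [z] between [s / 2] and [2 * s] the density bound is used with [S = 2 * s], and [1 / z] is
   bounded by its value at [s / 2]. *)
pose C := expR (b * (2 * s) * expR 1) / (s / 2).
have C0 : 0 <= C by rewrite divr_ge0 ?expR_ge0 ?divr_ge0 ?(ltW s0).
have sI : s \in (`](s / 2), (2 * s)[%classic : set R).
  by rewrite inE/= in_itv/=; apply/andP; split; lra.
pose f (z y : R) := expR (- (kappa * y)) * gamma_pdf y z.
have mf z : measurable_fun D (f z).
  by apply: measurable_funTS; rewrite /f /gamma_pdf; measurability.
have f0 z y : 0 <= f z y by apply: mulr_ge0; [exact: expR_ge0|exact: gamma_pdf_ge0].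
have fC z y : (`](s / 2), (2 * s)[%classic : set R) z -> 0 < y ->
    f z y <= C * expR (ln y - y).
  rewrite /= in_itv/= => /andP[z1 z2] y0.
  have z0 : 0 < z by apply: lt_trans z1; rewrite divr_gt0.
  apply: le_trans (resolvent_integrand_le b0 kappa0 z0 (ltW z2) y0) _.
  rewrite ler_wpM2r ?expR_ge0// ler_wpM2l ?expR_ge0//.
  by rewrite lef_pV2 ?posrE ?(ltW z1)// divr_gt0.
have ig : mu.-integrable D (EFin \o (fun y => C * expR (ln y - y))).
  apply: ge0_integrable.
  - by apply/measurable_EFinP; apply: measurable_funTS; measurability.
  - by move=> y _; rewrite lee_fin; apply: mulr_ge0; [exact: C0|exact: expR_ge0].
  - exact: integral_expR_lny.
apply: (@continuity_under_integral R _ _ mu f D (measurable_itv _) (s / 2) (2 * s)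
  _ _ (fun y => C * expR (ln y - y)) ig _ s sI).
- move=> z zI; apply: le_integrable ig; [exact: measurable_itv
    |by apply/measurable_EFinP; exact: mf|].
  move=> y; rewrite /= in_itv/= andbT => y0; rewrite lee_fin.
  rewrite ger0_norm ?f0// (le_trans (fC z y zI y0))//; exact: ler_norm.
- apply: aeW => y; rewrite /= in_itv/= andbT => y0 z.
  rewrite inE/= in_itv/= => /andP[z1 _]; rewrite /f.
  have z0 : 0 < z by apply: lt_trans z1; rewrite divr_gt0.
  by apply: cvgMr; exact: continuous_gamma_pdf.
- move=> z zI; apply: aeW => y; rewrite /= in_itv/= andbT => y0.
  by rewrite ger0_norm ?f0// fC.
Qed.

Lemma integrable_resolvent : mu.-integrable D (EFin \o resolvent).
Proof.
apply: ge0_integrable.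
- by apply/measurable_EFinP; apply: measurable_funTS; exact: measurable_resolvent.
- by move=> s _; rewrite lee_fin; exact: resolvent_ge0.
have E : (\int[mu]_(s in D) (resolvent s * 1)%:E =
    \int[mu]_(y in D) (expR (- (kappa * y)))%:E)%E.
  rewrite (@integral_resolventM _ b kappa b0 kappa0 (fun=> 1))//.
  apply: eq_integral => y /inDP y0; under eq_integral do rewrite mulr1.
  by rewrite gamma_mass// mule1.
have -> : (\int[mu]_(s in D) (EFin \o resolvent) s =
    \int[mu]_(s in D) (resolvent s * 1)%:E)%E.
  by apply: eq_integral => s _; rewrite mulr1.
by rewrite E integral_expRN_gt// ltry.
Qed.

(** The interval closed at 0 serves the limit of the primitive at 0, the half-open one its
    derivative. *)
Lemma integrable_resolvent_ocitv (t : R) (l : bool) :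
  mu.-integrable [set` Interval (BSide l 0) (BRight t)] (EFin \o resolvent).
Proof.
suff H : mu.-integrable `]0, t] (EFin \o resolvent).
  case: l => //; have [t0|t0] := leP 0 t; last first.
    rewrite set_itv_ge ?bnd_simp ?leNgt ?negbK//; exact: integrable_set0.
  apply/integrableP; split.
    by apply/measurable_EFinP; apply: measurable_funTS; exact: measurable_resolvent.
  rewrite -integral_itv_obnd_cbnd; first by have /integrableP[] := H.
  apply: measurableT_comp => //; apply/measurable_EFinP; apply: measurable_funTS.
  exact: measurable_resolvent.
apply: integrableS integrable_resolvent; [exact: measurable_itv|exact: measurable_itv|].
by move=> z; rewrite /= !in_itv/= andbT => /andP[].
Qed.

Definition resolvent_primitive (t : R) : R :=
  \int[mu]_(s in `]0, t]) resolvent s.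

Lemma resolvent_primitiveE t : 0 < t -> resolvent_primitive t = fine (mean_cdf t).
Proof.
move=> t0; congr fine; rewrite -integral_resolvent_lt// integral_indic_lt.
apply/esym/integral_itv_bndo_bndc.
by apply/measurable_EFinP; apply: measurable_funTS; exact: measurable_resolvent.
Qed.

Lemma resolvent_primitive0 : resolvent_primitive 0 = 0.
Proof. by rewrite /resolvent_primitive set_itv_ge ?bnd_simp ?ltxx// Rintegral_set0. Qed.

Lemma derive_resolvent_primitive (t : R) : 0 < t ->
  derivable resolvent_primitive t 1 /\ derive1 resolvent_primitive t = resolvent t.
Proof.
move=> t0.
apply: (@continuous_FTC1 R resolvent (BRight 0) t (t + 1)).
- by rewrite ltrDl.
- exact: (integrable_resolvent_ocitv _ false).
- by rewrite lte_fin.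
- exact: continuous_resolvent.
Qed.

Lemma cvg_resolvent_primitive0 : resolvent_primitive t @[t --> 0^'+] --> (0 : R).
Proof.
have H := @parameterized_integral_cvg_left R 0 1 resolvent ltr01
  (integrable_resolvent_ocitv 1 true).
have {}H := cvg_at_right_filter H.
apply: cvg_trans H; apply: near_eq_cvg; apply: nearW => t.
rewrite /parameterized_integral /resolvent_primitive Rintegral_itv_obnd_cbnd//.
exact: (integrable_resolvent_ocitv _ false).
Qed.

End resolvent_primitive.

Lemma levy_tailE (a b x : R) : 0 < b -> 0 < x -> levy_tail a b x = a * exp_int b x.
Proof.
move=> b0 x0; congr (a * _); congr fine.
rewrite integral_indic_ge ?(ltW x0)//; last by measurability.
apply: eq_integral => z; rewrite inE/= in_itv/= andbT => xz.
have z0 := lt_trans x0 xz.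
by rewrite expRD expRN [expR (- ln z)]expRN lnK.
Qed.

End solution.

(** * The explicit solution *)

Section relaxation.
Context {R : realType}.
Local Notation mu := (@lebesgue_measure R).
Local Notation D := (`]0%R, +oo[%classic : set R).
Variables a b c : R.
Hypotheses (a0 : 0 < a) (b0 : 0 < b) (c0 : 0 < c).
Local Notation kappa := (c / a).
Local Notation resolvent := (resolvent b kappa).
Local Notation resolvent_primitive := (resolvent_primitive b kappa).
Local Notation mean_cdf := (mean_cdf b kappa).
Local Notation exp_int := (exp_int b).

Let kappa0 : 0 < kappa. Proof. by rewrite divr_gt0. Qed.

Definition relaxation (t : R) : R := 1 - kappa * resolvent_primitive t.

Lemma is_derive_relaxation (t : R) : 0 < t ->
  is_derive t 1 relaxation (- (kappa * resolvent t)).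
Proof.
move=> t0; have [d dE] := derive_resolvent_primitive b0 kappa0 t0.
have dF : is_derive t (1 : R) resolvent_primitive (resolvent t).
  by rewrite -dE derive1E; exact: derivableP.
rewrite (_ : relaxation = cst 1 - kappa \*: resolvent_primitive)//.
by apply: is_derive_eq; rewrite sub0r.
Qed.

Lemma derive_relaxation (t : R) : 0 < t ->
  derive1 relaxation t = - (kappa * resolvent t).
Proof. by move=> t0; rewrite derive1E; have [_ ->] := is_derive_relaxation t0. Qed.

Lemma continuous_relaxation (t : R) : 0 < t -> {for t, continuous relaxation}.
Proof.
move=> t0; apply: differentiable_continuous; apply/derivable1_diffP.
by have [] := is_derive_relaxation t0.
Qed.

Lemma relaxation_AC : AC_halfline relaxation.
Proof.
have mI (s t : R) := integrable_resolvent_ocitv b0 kappa0.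
split.
- rewrite continuous_open_subspace//. 
  by move=> t; rewrite inE/= in_itv/= andbT => /continuous_relaxation.
- by apply: aeW => t t0; have [] := is_derive_relaxation t0.
- have ir := integrable_resolvent b0 kappa0.
  have := @integrableZl _ _ _ mu D (measurable_itv _) (- kappa) _ ir.
  apply: eq_integrable; first exact: measurable_itv.
  move=> t /inDP t0; rewrite /= derive_relaxation//.
  by rewrite -EFinM mulNr.
- move=> s t s0 st.
  have E : \int[mu]_(r in `[s, t]) derive1 relaxation r =
      - kappa * \int[mu]_(r in `]s, t]) resolvent r.
    have iI : mu.-integrable `[s, t] (EFin \o resolvent).
      apply: integrableS (integrable_resolvent b0 kappa0);
        [exact: measurable_itv|exact: measurable_itv|].
      by move=> z; rewrite /= !in_itv/= andbT => /andP[/(lt_le_trans s0)].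
    rewrite Rintegral_itv_obnd_cbnd; last first.
      apply: integrableS iI; [exact: measurable_itv|exact: measurable_itv|].
      by move=> z; rewrite /= !in_itv/= => /andP[/ltW -> ->].
    rewrite -RintegralZl//.
    apply: eq_Rintegral => r; rewrite inE/= in_itv/= => /andP[/(lt_le_trans s0) r0 _].
    by rewrite derive_relaxation// mulNr.
  rewrite E -(@Rintegral_itvB _ resolvent (BRight 0) (BRight t) s).
  + by rewrite /relaxation /resolvent_primitive; ring.
  + exact: (integrable_resolvent_ocitv b0 kappa0 t false).
  + by rewrite bnd_simp ltW.
  + by rewrite bnd_simp.
Qed.

Lemma integral_caputo_kernel (u : R -> R) (t : R) : 0 < t ->
  (caputo a b u t =
   \int[mu]_(s in `]0%R, t[) (a * (derive1 u s * exp_int (t - s)))%:E)%E.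
Proof.
move=> t0; apply: eq_integral => s; rewrite inE/= in_itv/= => /andP[s0 st].
by rewrite levy_tailE ?subr_gt0// mulrCA.
Qed.

(** With [u' = - kappa * r] the left side is [- a * kappa] times the convolution [r * h], which is
    [1 - kappa * \int r], the solution itself; and [a * kappa = c]. *)
Lemma relaxation_caputo (t : R) : 0 < t ->
  caputo a b relaxation t = (- (c * relaxation t))%:E.
Proof.
move=> t0; rewrite integral_caputo_kernel//.
have E : (\int[mu]_(s in `]0%R, t[) (resolvent s * exp_int (t - s))%:E =
    (relaxation t)%:E)%E.
  rewrite -integral_indic_lt /relaxation resolvent_primitiveE//.
  rewrite -integral_resolvent_exp_int//.
  by apply: eq_integral => s _; rewrite -mulrA [exp_int _ * _]mulrC.
have me : measurable_fun setT (fun s : R => exp_int (t - s)).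
  by apply: (measurableT_comp (measurable_exp_int b)); measurability.
have ir : mu.-integrable `]0, t[ (fun s => (resolvent s * exp_int (t - s))%:E).
  apply: ge0_integrable.
  - apply/measurable_EFinP; apply: measurable_funTS; apply: measurable_funM => //.
    exact: measurable_resolvent.
  - by move=> s _; rewrite lee_fin; apply: mulr_ge0; [exact: resolvent_ge0
    |exact: exp_int_ge0].
  - by rewrite E ltry.
have -> : (- (c * relaxation t))%:E = ((- c)%:E * (relaxation t)%:E)%E.
  by rewrite -EFinM mulNr.
rewrite -E -integralZl//.
apply: eq_integral => s; rewrite inE/= in_itv/= => /andP[s0 st].
rewrite derive_relaxation// -EFinM; congr EFin.
move: (resolvent s) (exp_int (t - s)) => p q; field; exact: lt0r_neq0.
Qed.

Theorem relaxation_solution : caputo_solution a b c relaxation.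
Proof.
split.
- apply/continuous_within_itvcyP; split.
    by move=> t; rewrite in_itv/= andbT => /continuous_relaxation.
  rewrite /relaxation resolvent_primitive0.
  apply: cvgB; first exact: cvg_cst.
  by apply: cvgMr; exact: cvg_resolvent_primitive0.
- exact: relaxation_AC.
- by rewrite /relaxation resolvent_primitive0 mulr0 subr0.
- exact: relaxation_caputo.
Qed.

End relaxation.

(** * Uniqueness by a triple convolution *)

Section uniqueness.
Context {R : realType}.
Local Notation mu := (@lebesgue_measure R).
Local Notation D := (`]0%R, +oo[%classic : set R).

Section primitive.
Variable u : R -> R.
Hypotheses (cu : {within `[0, +oo[, continuous u}) (acu : AC_halfline u).

(** Extended by 0 so that convolutions become integrals over the whole line: nothing is known about
    the derivative outside []0, +oo[]. *)
Definition halfline_derivative : R -> R := derive1 u \_ D.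

Lemma halfline_derivativeE (s : R) : 0 < s -> halfline_derivative s = derive1 u s.
Proof. by move=> s0; rewrite /halfline_derivative patchE mem_setE in_itv/= s0. Qed.

Lemma integrable_halfline_derivative :
  mu.-integrable setT (EFin \o halfline_derivative).
Proof.
have [_ _ iu _] := acu.
rewrite /halfline_derivative -restrict_EFin; apply/integrable_restrict => //=.
by rewrite setTI.
Qed.

Lemma integral_halfline_derivative (t : R) : 0 < t ->
  \int[mu]_(s in `]0, t]) halfline_derivative s = u t - u 0.
Proof.
move=> t0; have [_ _ _ acE] := acu.
have im := integrable_halfline_derivative.
have iI (E : set R) : measurable E -> mu.-integrable E (EFin \o halfline_derivative).
  by move=> mE; apply: integrableS im.
pose F s := \int[mu]_(r in `]0, s]) halfline_derivative r.
have E s : 0 < s -> s <= t -> F t = u t - u s + F s.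
  move=> s0 st; rewrite acE//.
  have -> : \int[mu]_(r in `[s, t]) derive1 u r =
      \int[mu]_(r in `]s, t]) halfline_derivative r.
    rewrite Rintegral_itv_obnd_cbnd; last exact: iI.
    apply: eq_Rintegral => r; rewrite inE/= in_itv/= => /andP[/(lt_le_trans s0) r0 _].
    by rewrite halfline_derivativeE.
  rewrite -(@Rintegral_itvB _ halfline_derivative (BRight 0) (BRight t) s) ?subrK//.
  - exact: iI.
  - by rewrite bnd_simp ltW.
have F0 : F s @[s --> 0^'+] --> (0 : R).
  have H := @parameterized_integral_cvg_left R 0 1 halfline_derivative ltr01
    (iI _ (measurable_itv _)).
  have {}H := cvg_at_right_filter H.
  apply: cvg_trans H; apply: near_eq_cvg; apply: nearW => s.
  rewrite /parameterized_integral /F Rintegral_itv_obnd_cbnd//; exact: iI.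
have u0 : u s @[s --> 0^'+] --> u 0 by have /continuous_within_itvcyP[] := cu.
have H : u t - u s + F s @[s --> 0^'+] --> u t - u 0 + 0.
  by apply: cvgD => //; apply: cvgB => //; exact: cvg_cst.
rewrite addr0 in H.
(* Absolute continuity speaks of positive times only. By it this expression does not depend on [s]
   near 0, and the continuity of [u] at 0 identifies its limit. *)
have Hc : u t - u s + F s @[s --> 0^'+] --> F t.
  apply: (cvg_trans _ (@cvg_cst _ (F t) _ (0 : R)^'+ _)).
  apply: near_eq_cvg; near=> s; apply: E.
    by near: s; exact: nbhs_right_gt.
  by near: s; exact: nbhs_right_le.
exact: (cvg_unique (@Rhausdorff R) Hc H).
Unshelve. all: by end_near. Qed.

End primitive.

Variables a b c : R.
Hypotheses (a0 : 0 < a) (b0 : 0 < b) (c0 : 0 < c).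
Local Notation kappa := (c / a).
Local Notation resolvent := (resolvent b kappa).
Local Notation exp_int := (exp_int b).

Let kappa0 : 0 < kappa. Proof. by rewrite divr_gt0. Qed.

Variable u : R -> R.
Hypothesis solu : caputo_solution a b c u.

Let f := halfline_derivative u.

Let cu : {within `[0, +oo[, continuous u}. Proof. by have [] := solu. Qed.
Let acu : AC_halfline u. Proof. by have [] := solu. Qed.
Let u0 : u 0 = 1. Proof. by have [] := solu. Qed.

Let if_ (E : set R) : measurable E -> mu.-integrable E (EFin \o f).
Proof. by move=> mE; apply: integrableS (integrable_halfline_derivative acu). Qed.

Let mf : measurable_fun setT f.
Proof. by have /integrableP[/measurable_EFinP] := if_ measurableT. Qed.

Let kernel (x : R) : R := exp_int x + kappa.

Let kernel_ge0 x : 0 <= kernel x.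
Proof. by rewrite addr_ge0 ?exp_int_ge0// ltW. Qed.

Let measurable_kernel : measurable_fun setT kernel.
Proof. by apply: measurable_funD; [exact: measurable_exp_int
  |exact: measurable_cst]. Qed.

Let integral_f (t : R) : 0 < t -> (\int[mu]_(s in `]0%R, t[) (f s)%:E = (u t - 1)%:E)%E.
Proof.
move=> t0; rewrite -u0 -(integral_halfline_derivative cu acu t0) /Rintegral fineK.
  rewrite integral_itv_bndo_bndc//.
  by apply/measurable_EFinP; exact: measurable_funTS.
by apply: integrable_fin_num; [exact: measurable_itv|exact: if_].
Qed.

(** The equation gives [- kappa * u t] for the part with [exp_int], and the primitive gives
    [kappa * (u t - 1)] for the constant part. *)
Let integral_f_kernel (t : R) : 0 < t ->
  (\int[mu]_(s in `]0%R, t[) (f s * kernel (t - s))%:E = (- kappa)%:E)%E.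
Proof.
move=> t0.
have me : measurable_fun setT (fun s : R => exp_int (t - s)).
  by apply: (measurableT_comp (measurable_exp_int b)); measurability.
have mI : measurable (`]0%R, t[%classic : set R) by exact: measurable_itv.
have mfe : measurable_fun `]0, t[ (fun s => f s * exp_int (t - s)).
  by apply: measurable_funTS; exact: measurable_funM.
have E : (\int[mu]_(s in `]0%R, t[) (a * (f s * exp_int (t - s)))%:E = (- (c * u
  t))%:E)%E.
  have [_ _ _ sol] := solu.
  rewrite -(sol t t0) (@integral_caputo_kernel _ a b b0 u t t0).
  apply: eq_integral => s; rewrite inE/= in_itv/= => /andP[s0 _].
  by rewrite /f halfline_derivativeE.
have ife : mu.-integrable `]0, t[ (fun s => (f s * exp_int (t - s))%:E).
  (* The equation makes the integral finite, and in [\bar R] a finite integral of a measurable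
     function entails absolute integrability. *)
  have iafe : mu.-integrable `]0, t[ (fun s => (a * (f s * exp_int (t - s)))%:E).
    apply/integrableP; split.
      by apply/measurable_EFinP; exact: measurable_funM.
    by rewrite integral_fin_num_abs// ?E//; exact: measurable_funM.
  have := @integrableZl _ _ _ mu _ mI (a^-1) _ iafe.
  apply: eq_integrable => // s _.
  by rewrite /= -EFinM mulKf// lt0r_neq0.
have Efe : (\int[mu]_(s in `]0%R, t[) (f s * exp_int (t - s))%:E = (- (kappa * u
  t))%:E)%E.
  have := E; under eq_integral do rewrite EFinM.
  rewrite integralZl// => {}E.
  have fin : (\int[mu]_(s in `]0%R, t[) (f s * exp_int (t - s))%:E)%E \is a fin_num.
    exact: integrable_fin_num.
  rewrite -(fineK fin) -EFinM in E; move: E => [E].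
  rewrite -(fineK fin); congr EFin; apply: (mulfI (lt0r_neq0 a0)); rewrite E.
  by field; exact: lt0r_neq0.
transitivity (\int[mu]_(s in `]0%R, t[) ((f s * exp_int (t - s))%:E + kappa%:E *
  (f s)%:E))%E.
  by apply: eq_integral => s _; rewrite -EFinM -EFinD /kernel mulrDr [f s * kappa]mulrC.
rewrite integralD//; last by apply: integrableZl => //; exact: if_.
rewrite integralZl//; last exact: if_.
rewrite Efe integral_f// -EFinM -EFinD; congr EFin; ring.
Qed.

Let rm : R -> R := resolvent \_ D.

Let rm_ge0 s : 0 <= rm s.
Proof. by rewrite /rm patchE; case: ifP => // _; exact: resolvent_ge0. Qed.

Let mrm : measurable_fun setT rm.
Proof.
apply/(measurable_restrictT resolvent); first exact: measurable_itv.
by apply: measurable_funTS; exact: measurable_resolvent.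
Qed.

Let rmE s : 0 < s -> rm s = resolvent s.
Proof. by move=> s0; rewrite /rm patchE mem_setE in_itv/= s0. Qed.

Let outD (g : R -> R) (s : R) : s <= 0 -> (g \_ D) s = 0.
Proof. by move=> s0; rewrite patchE mem_setE in_itv/= ltNge s0. Qed.

(* Integrating [s] first or [v] first evaluates the triple convolution of the
   derivative, the resolvent and the kernel in two ways. *)
Let triple t (p : R * R) : R :=
  f p.1 * (rm p.2 * ((p.2 < t - p.1)%R%:R * kernel (t - p.1 - p.2))).

Let measurable_triple t : measurable_fun setT (EFin \o triple t).
Proof.
apply/measurable_EFinP; apply: measurable_funM.
  by apply: (measurableT_comp mf).
apply: measurable_funM; first by apply: (measurableT_comp mrm).
apply: measurable_funM; first by measurability.
by apply: (measurableT_comp measurable_kernel); measurability.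
Qed.

Let setT_D (g : R -> \bar R) : (forall s, s <= 0 -> g s = 0%E) ->
  (\int[mu]_s g s = \int[mu]_(s in D) g s)%E.
Proof.
move=> g0; rewrite [RHS]integral_mkcond; apply: eq_integral => s _.
rewrite patchE mem_setE in_itv/= andbT; case: ltP => //; exact: g0.
Qed.

Let integral_rm (x : R) : 0 < x ->
  (\int[mu]_v (rm v * ((v < x)%R%:R * kernel (x - v)))%:E = 1)%E.
Proof.
move=> x0; rewrite setT_D; last by move=> v v0; rewrite /rm outD// mul0r.
rewrite -(resolvent_convolution b0 kappa0 x0).
by apply: eq_integral => v /inDP v0; rewrite rmE.
Qed.

Let measurable_rm_kernel (x : R) :
  measurable_fun setT (fun v => rm v * ((v < x)%R%:R * kernel (x - v))).
Proof.
apply: measurable_funM => //; apply: measurable_funM; first by measurability.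
by apply: (measurableT_comp measurable_kernel); measurability.
Qed.

Let rm_kernel_ge0 (x v : R) : 0 <= rm v * ((v < x)%R%:R * kernel (x - v)).
Proof. by apply: mulr_ge0 => //; apply: mulr_ge0. Qed.

(** Every factor except [f] is nonnegative, so the resolvent identity evaluates the integral of the
    absolute value exactly; integrability of the triple then rests on that of [f] alone. *)
Let integral_triple_abs t (s : R) : 0 < s ->
  (\int[mu]_v `|(EFin \o triple t) (s, v)| = (`|f s| * (s < t)%R%:R)%:E)%E.
Proof.
move=> s0; rewrite /triple/=.
transitivity (\int[mu]_v (`|f s| * (rm v * ((v < t - s)%R%:R * kernel (t - s -
  v))))%:E)%E.
  by apply: eq_integral => v _; rewrite normrM [X in _ * X]ger0_norm.
rewrite ge0_integralMl; [|exact: measurableT|exact: normr_ge0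
  |exact: measurable_rm_kernel|exact: rm_kernel_ge0].
have [st|ts] := ltP s t; first by rewrite integral_rm ?subr_gt0// mule1 mulr1.
rewrite mulr0 integral0_eq ?mule0// => v _.
have [v0|v0] := ltP 0 v; last by rewrite /rm outD// mul0r.
by rewrite ltNge (le_trans _ (ltW v0)) ?subr_le0//= mul0r mulr0.
Qed.

Let integrable_triple t : (mu \x mu)%E.-integrable setT (EFin \o triple t).
Proof.
apply/(@integrable12ltyP _ _ _ _ _ mu mu (EFin \o triple t));
  first exact: measurable_triple.
rewrite setT_D; last first.
  move=> s s0; rewrite integral0_eq// => v _.
  by rewrite /= /triple/= /f /halfline_derivative outD// mul0r normr0.
have /integrableP[_ fin] := if_ (measurable_itv `]0, +oo[).
apply: le_lt_trans fin; apply: ge0_le_integral; [exact: measurable_itv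
  |by move=> s _; exact: integral_ge0| | |].
- apply: measurable_funTS.
  apply: (@measurable_integral_on _ _ _ _ _ mu setT (fun p => `|(EFin \o triple
    t) p|%E)) => //.
  by apply: measurableT_comp => //; exact: measurable_triple.
- apply: measurable_funTS; apply: measurableT_comp => //; exact/measurable_EFinP.
- move=> s; rewrite /= in_itv/= andbT => s0; rewrite integral_triple_abs//.
  by rewrite lee_fin ler_piMr// lern1 leq_b1.
Qed.

Let fubini_sv t : 0 < t ->
  (\int[mu]_s \int[mu]_v (EFin \o triple t) (s, v) = (u t - 1)%:E)%E.
Proof.
move=> t0; rewrite setT_D; last first.
  move=> s s0; rewrite integral0_eq// => v _.
  by rewrite /= /triple/= /f /halfline_derivative outD// mul0r.
rewrite -integral_f// -integral_indic_lt.
apply: eq_integral => s /inDP s0; rewrite /triple/=.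
have [st|ts] := ltP s t.
  have x0 : 0 < t - s by rewrite subr_gt0.
  have i1 : mu.-integrable setT (fun v =>
      (rm v * ((v < t - s)%R%:R * kernel (t - s - v)))%:E).
    apply: ge0_integrable.
    - by apply/measurable_EFinP; exact: measurable_rm_kernel.
    - by move=> v _; rewrite lee_fin; exact: rm_kernel_ge0.
    - by rewrite integral_rm// ltry.
  under eq_integral do rewrite EFinM.
  by rewrite integralZl// integral_rm// mule1 mulr1.
rewrite mulr0 integral0_eq// => v _.
have [v0|v0] := ltP 0 v; last by rewrite /rm outD// mul0r mulr0.
by rewrite ltNge (le_trans _ (ltW v0)) ?subr_le0//= mul0r !mulr0.
Qed.

Let fubini_vs t : 0 < t ->
  (\int[mu]_v \int[mu]_s (EFin \o triple t) (s, v) =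
   (- (kappa * resolvent_primitive b kappa t))%:E)%E.
Proof.
move=> t0; rewrite setT_D; last first.
  move=> v v0; rewrite integral0_eq// => s _.
  by rewrite /= /triple/= /rm outD// mul0r mulr0.
transitivity (\int[mu]_(v in D) ((- kappa)%:E * (resolvent v * (v <
  t)%R%:R)%:E))%E; last first.
  rewrite integralZl; [|exact: measurable_itv|]; last first.
    apply: ge0_integrable.
    - apply: measurable_funTS; apply/measurable_EFinP; apply: measurable_funM.
        exact: measurable_resolvent.
      by measurability.
    - by move=> v _; rewrite lee_fin; apply: mulr_ge0; [exact: resolvent_ge0|].
    - by rewrite integral_resolvent_lt// ltey_eq (mean_cdf_fin b0 kappa0).
  rewrite integral_resolvent_lt// resolvent_primitiveE//.
  by rewrite -[X in (_ * X)%E](fineK (mean_cdf_fin b0 kappa0 t)) -EFinM mulNr.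
apply: eq_integral => v /inDP v0; rewrite /triple/= rmE//.
have [vt|tv] := ltP v t; last first.
  rewrite mulr0 mule0 integral0_eq// => s _.
  have [s0|s0] := ltP 0 s; last by rewrite /f /halfline_derivative outD// mul0r.
  by rewrite ltNge (le_trans _ tv) ?mul0r ?mulr0// lerBlDr lerDl ltW.
have x0 : 0 < t - v by rewrite subr_gt0.
rewrite mulr1 setT_D; last first.
  by move=> s s0; rewrite /f /halfline_derivative outD// mul0r.
transitivity (\int[mu]_(s in `]0%R, (t - v)%R[)
    ((resolvent v)%:E * (f s * kernel (t - v - s))%:E))%E.
  have H := integral_indic_lt (t - v) (fun s => resolvent v * (f s * kernel (t -
    v - s))).
  under [RHS]eq_integral do rewrite -EFinM.
  rewrite -H; apply: eq_integral => s _; congr EFin.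
  have -> : (v < t - s) = (s < t - v) by rewrite ltrBrDr addrC -ltrBrDr.
  have -> : t - s - v = t - v - s by ring.
  by move: (resolvent v) (kernel _) (f s) => p q w; ring.
have E := integral_f_kernel x0.
rewrite integralZl; [|exact: measurable_itv|].
  by rewrite E -!EFinM mulrC.
apply/integrableP; split.
  apply/measurable_EFinP; apply: measurable_funTS; apply: measurable_funM => //.
  by apply: (measurableT_comp measurable_kernel); measurability.
rewrite integral_fin_num_abs ?E//; apply: measurable_funTS;
  apply: measurable_funM => //.
by apply: (measurableT_comp measurable_kernel); measurability.
Qed.

Theorem caputo_solution_unique (t : R) : 0 <= t -> u t = relaxation a b c t.
Proof.
rewrite le_eqVlt => /predU1P[<-|t0].
  by rewrite u0 /relaxation resolvent_primitive0 mulr0 subr0.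
have := Fubini (integrable_triple t).
rewrite (fubini_sv t0) (fubini_vs t0) => -[E].
by rewrite /relaxation -[LHS](subrK 1) E addrC.
Qed.

End uniqueness.

(** * Representations by nu *)

Section representation.
Context {R : realType}.
Local Notation mu := (@lebesgue_measure R).
Local Notation D := (`]0%R, +oo[%classic : set R).

(** This covers all uses of [nu] below: for [alpha >= -1] and [y > 0] the argument [alpha + y + 1]
    is positive. *)
Lemma rGammaE (x : R) : 0 < x -> rGamma x = (Gamma x)^-1.
Proof.
move=> x0; rewrite /rGamma.
have -> : Num.truncn (1 - x) = 0%N.
  by apply/truncn0Pn; rewrite -ltNge gtrBl.
by rewrite big_ord0 addr0 mul1r.
Qed.

Variable b : R.
Hypothesis b0 : 0 < b.
Local Notation gamma_pdf := (gamma_pdf b).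
Local Notation gamma_cdf := (gamma_cdf b).
Local Notation gamma_tail := (gamma_tail b).
Local Notation gcdf := (gcdf b).

(** For a natural number [z] this is the Poisson probability of [z] with mean [b * t]. *)
Definition poisson_weight (z t : R) : R :=
  expR (z * ln (b * t) - b * t - ln (Gamma (z + 1))).

Lemma gamma_tail1 (x : R) : 0 < x -> gamma_tail 1 x = expR (- (b * x)).
Proof.
move=> x0; apply: EFin_inj; rewrite gamma_tail_fin//.
transitivity (\int[mu]_(z in D) (b * (expR (- (b * z)) * (x <= z)%R%:R))%:E)%E.
  apply: eq_integral => z _; rewrite mulrA; congr ((_ * _)%:E).
  rewrite /gamma_pdf Gamma1 ln1 subr0 subrr mul0r addr0 mul1r expRD lnK//.
have -> : (\int[mu]_(z in D) (b * (expR (- (b * z)) * (x <= z)%R%:R))%:E =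
    b%:E * \int[mu]_(z in D) (expR (- (b * z)) * (x <= z)%R%:R)%:E)%E.
  by apply: ge0_integralMl; [exact: measurable_itv|exact: ltW|by measurability
    |by move=> z; rewrite mulr_ge0 ?expR_ge0].
rewrite integral_indic_ge ?(ltW x0)//; last by measurability.
rewrite integral_expRN_gt// -EFinM; congr EFin; field; exact: lt0r_neq0.
Qed.

(** The splitting is used at [e = 1], where the second law is exponential: [expR (- (b * s))] and
    the tail [expR (- (b * (t - s)))] multiply to a constant in [s], and only a power is left to
    integrate. *)
Lemma gcdf_step (y t : R) : 0 < y -> 0 < t ->
  gcdf y t = gcdf (y + 1) t + poisson_weight y t.
Proof.
move=> y0 t0.
suff : (gamma_cdf y t = gamma_cdf (y + 1) t + (poisson_weight y t)%:E)%E.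
  by rewrite -(gcdf_fin b0 t y0) -(gcdf_fin b0 t (addr_gt0 y0 ltr01)) -EFinD => -[].
rewrite (gamma_cdf_split b0 y0 ltr01 t0); congr (_ + _)%E.
have G0 := Gamma_gt0 y0.
transitivity (\int[mu]_(s in D) (expR (y * ln b - ln (Gamma y) - b * t) *
    (expR ((y - 1) * ln s) * (s < t)%R%:R))%:E)%E.
  apply: eq_integral => s _; rewrite /tail_weight; congr EFin.
  have [st|_] := ltP s t; last by rewrite mul0r !mulr0.
  rewrite mul1r mulr1 gamma_tail1 ?subr_gt0// /gamma_pdf -!expRD.
  by congr expR; ring.
rewrite ge0_integralMl; [|exact: measurable_itv|exact: expR_ge0|by measurability
  |by move=> s; rewrite mulr_ge0 ?expR_ge0].
have -> : (\int[mu]_(s in D) (expR ((y - 1) * ln s) * (s < t)%R%:R)%:E =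
    (t `^ y / y)%:E)%E.
  rewrite integral_indic_lt -integral_powR0// -integral_itv_bndo_bndc; last first.
    by apply/measurable_EFinP; apply: measurable_funTS; exact: measurable_powR.
  apply: eq_integral => s; rewrite inE/= in_itv/= => /andP[s0 _].
  by rewrite powR_exp_ln.
rewrite -EFinM; congr EFin; rewrite powR_exp_ln// /poisson_weight GammaS//.
rewrite -[X in _ / X](lnK y0) -expRN -!expRD !lnM ?posrE//.
by congr expR; ring.
Qed.

(** The choice [M = b * t * expR 1] again yields a factor [expR (- z)]; this decay makes the
    remainder of the telescoping sum vanish. *)
Lemma gcdf_le (z t : R) : 0 < z -> 0 < t -> gcdf z t <= expR (b * t * expR 1) *
  expR (- z).
Proof.
move=> z0 t0.
have M0 : 0 < b * t * expR 1 by rewrite !mulr_gt0 ?expR_gt0.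
rewrite -lee_fin (gcdf_fin b0 t z0).
pose K := expR (b * t * expR 1 - z * ln (b * t * expR 1) + z * ln b).
pose k := z * K.
have k0 : 0 <= k by rewrite mulr_ge0 ?expR_ge0 ?(ltW z0).
apply: (@le_trans _ _ (\int[mu]_(s in D) (k * (expR ((z - 1) * ln s) * (s <
  t)%R%:R))%:E)%E).
  apply: ge0_le_integral; [exact: measurable_itv
    |by move=> s _; rewrite lee_fin mulr_ge0 ?expR_ge0
    |by apply: measurable_funTS; rewrite /gamma_pdf; measurability
    |by apply: measurable_funTS; measurability|].
  move=> s; rewrite /= in_itv/= andbT => s0; rewrite lee_fin mulrA ler_wpM2r//.
  rewrite gamma_pdfE// /k -mulrA ler_pM2l// /K -expRD.
  apply: (@le_trans _ _ (expR (b * t * expR 1 - z * ln (b * t * expR 1)) *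
      expR (z * ln (b * s) - b * s - ln s))).
    by rewrite ler_wpM2r ?expR_ge0// invr_Gamma_le.
  rewrite -expRD ler_expR [ln (b * s)]lnM ?posrE//.
  have : 0 <= b * s by rewrite mulr_ge0 ?ltW.
  lra.
rewrite ge0_integralMl; [|exact: measurable_itv|exact: k0|by measurability
  |by move=> s; rewrite mulr_ge0 ?expR_ge0].
have -> : (\int[mu]_(s in D) (expR ((z - 1) * ln s) * (s < t)%R%:R)%:E =
    (t `^ z / z)%:E)%E.
  rewrite integral_indic_lt -integral_powR0// -integral_itv_bndo_bndc; last first.
    by apply/measurable_EFinP; apply: measurable_funTS; exact: measurable_powR.
  apply: eq_integral => s; rewrite inE/= in_itv/= => /andP[s0 _].
  by rewrite powR_exp_ln.
rewrite -EFinM lee_fin powR_exp_ln//.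
have -> : k * (expR (z * ln t) / z) = K * expR (z * ln t).
  by rewrite /k; field; exact: lt0r_neq0.
rewrite /K -!expRD ler_expR lnM ?posrE ?expR_gt0 ?mulr_gt0// expRK lnM ?posrE//.
by rewrite le_eqVlt; apply/orP; left; apply/eqP; ring.
Qed.

Lemma poisson_weight_sum (y t : R) (N : nat) : 0 < y -> 0 < t ->
  \sum_(0 <= n < N) poisson_weight (n%:R + y) t = gcdf y t - gcdf (N%:R + y) t.
Proof.
move=> y0 t0; elim: N => [|N IH].
  by rewrite big_nil add0r subrr.
have yN : 0 < N%:R + y by rewrite ltr_wpDl.
rewrite big_nat_recr; last by [].
have -> : N.+1%:R + y = N%:R + y + 1 by rewrite -natr1; ring.
have aux (p q r w : R) : q = r + w -> p - q + w = p - r by move=> ->; ring.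
transitivity (gcdf y t - gcdf (N%:R + y) t + poisson_weight (N%:R + y) t).
  by congr (_ + _).
exact: aux (gcdf_step yN t0).
Qed.

Lemma nneseries_poisson_weight (y t : R) : 0 < y -> 0 < t ->
  (\sum_(0 <= n <oo) (poisson_weight (n%:R + y) t)%:E = (gcdf y t)%:E)%E.
Proof.
move=> y0 t0; apply/cvg_lim => //.
rewrite (_ : (fun N => _) = EFin \o (fun N => gcdf y t - gcdf (N%:R + y) t));
  last first.
  by apply/funext => N; rewrite sumEFin poisson_weight_sum.
apply: cvg_EFin; first exact: nearW.
rewrite -[X in _ --> X]subr0; apply: cvgB; first exact: cvg_cst.
pose K := expR (b * t * expR 1).
have cK : K * expR (- N%:R) @[N --> \oo] --> (0 : R).
  by rewrite -(mulr0 K); apply: cvgMr; exact: cvgn_expR.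
have c0 : (0 : R) @[_ --> \oo] --> (0 : R) by exact: cvg_cst.
apply: (squeeze_cvgr _ c0 cK); apply: nearW => N; rewrite gcdf_ge0/=.
apply: le_trans (gcdf_le _ t0) _; first by rewrite ltr_wpDl.
by rewrite ler_wpM2l ?expR_ge0// ler_expR lerN2 lerDl ltW.
Qed.

Variable kappa : R.
Hypothesis kappa0 : 0 < kappa.
Local Notation resolvent := (resolvent b kappa).
Local Notation mean_cdf := (mean_cdf b kappa).

(** The power [-1 + y] in [nu] is that of [s] in the gamma density, and [expR (- kappa)] raised to
    it supplies the damping in [y]; [k] collects what is independent of [y]. *)
Lemma resolvent_nu (s : R) : 0 < s ->
  b * expR (- kappa) * (expR (- (b * s)) * nu (b * s * expR (- kappa)) (- 1)) =
  resolvent s.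
Proof.
move=> s0; pose k := expR (kappa + b * s - ln b).
have -> : nu (b * s * expR (- kappa)) (- 1) = k * resolvent s.
  apply: EFin_inj; rewrite EFinM resolvent_fin//.
  rewrite -ge0_integralMl; [|exact: measurable_itv|exact: expR_ge0
    |by rewrite /gamma_pdf; measurability
    |by move=> y; rewrite mulr_ge0 ?expR_ge0].
  rewrite /nu /Rintegral.
  have E : (\int[mu]_(y in D) ((b * s * expR (- kappa)) `^ (-1 + y) *
        rGamma (-1 + y + 1))%:E =
      \int[mu]_(y in D) (k * (expR (- (kappa * y)) * gamma_pdf y s))%:E)%E.
    apply: eq_integral => y /inDP y0; have G0 := Gamma_gt0 y0.
    have -> : -1 + y + 1 = y by ring.
    rewrite rGammaE// powR_exp_ln ?mulr_gt0 ?expR_gt0// -[X in X^-1](lnK G0) -expRN.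
    rewrite !lnM ?posrE ?mulr_gt0 ?expR_gt0// expRK /k /gamma_pdf -!expRD.
    by congr ((expR _)%:E); ring.
  rewrite E fineK// ge0_integralMl; [|exact: measurable_itv|exact: expR_ge0
    |by rewrite /gamma_pdf; measurability
    |by move=> y; rewrite mulr_ge0 ?expR_ge0].
  by rewrite -resolvent_fin// -EFinM.
rewrite -[X in X * _ * _](lnK b0) /k; move: (resolvent s) => r.
rewrite [RHS](_ : _ = 1 * r); last by rewrite mul1r.
rewrite !mulrA -!expRD -expR0; congr (expR _ * _); ring.
Qed.

(** The power in [nu] contains [expR (- (kappa * (n + y)))]; the coefficient [expR (kappa * n)] of
    the series cancels its part in [n]. *)
Lemma nu_series_term (t : R) (n : nat) : 0 < t ->
  (\int[mu]_(y in D) (expR (- (kappa * y)) * poisson_weight (n%:R + y) t)%:E =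
   (expR (- (b * t)) *
     (expR (kappa * n%:R) * nu (b * t * expR (- kappa)) n%:R))%:E)%E.
Proof.
move=> t0.
have mw : measurable_fun setT
    (fun y : R => expR (- (kappa * y)) * poisson_weight (n%:R + y) t).
  by rewrite /poisson_weight; measurability.
have w0 y : 0 <= expR (- (kappa * y)) * poisson_weight (n%:R + y) t.
  by rewrite mulr_ge0 ?expR_ge0.
have fin : (\int[mu]_(y in D)
    (expR (- (kappa * y)) * poisson_weight (n%:R + y) t)%:E)%E \is a fin_num.
  rewrite ge0_fin_numE; last by apply: integral_ge0 => y _; rewrite lee_fin.
  apply: (@le_lt_trans _ _ (mean_cdf t)); last by rewrite ltey_eq mean_cdf_fin.
  apply: ge0_le_integral; [exact: measurable_itv|by move=> y _; rewrite lee_fin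
    |by apply: measurable_funTS; exact/measurable_EFinP
    |by apply/measurable_EFinP; apply: measurable_funTS;
      exact: measurable_mean_cdf_integrand|].
  move=> y; rewrite /= in_itv/= andbT => y0; rewrite lee_fin ler_wpM2l ?expR_ge0//.
  (* A term of a nonnegative series is at most the sum, here [gcdf y t]; the partial sum up to
     [n.+1] is the first one that contains the term of index [n]. *)
  rewrite -lee_fin -nneseries_poisson_weight//.
  have := @nneseries_lim_ge R (fun n => (poisson_weight (n%:R + y) t)%:E) xpredT 0 n.+1.
  move=> /(_ (fun n _ _ => expR_ge0 _)).
  rewrite big_nat_recr//=; apply: le_trans; rewrite leeDr// sume_ge0// => i _.
  by rewrite lee_fin expR_ge0.
rewrite -(fineK fin); congr EFin.
pose k := expR (b * t - kappa * n%:R).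
have N : nu (b * t * expR (- kappa)) n%:R = k * fine (\int[mu]_(y in D)
    (expR (- (kappa * y)) * poisson_weight (n%:R + y) t)%:E)%E.
  apply: EFin_inj; rewrite EFinM (fineK fin).
  rewrite -ge0_integralMl; [|exact: measurable_itv|exact: expR_ge0|exact: mw|exact: w0].
  have E : (\int[mu]_(y in D) ((b * t * expR (- kappa)) `^ (n%:R + y) *
        rGamma (n%:R + y + 1))%:E = \int[mu]_(y in D)
      (k * (expR (- (kappa * y)) * poisson_weight (n%:R + y) t))%:E)%E.
    apply: eq_integral => y /inDP y0; have y1 : 0 < n%:R + y + 1.
      by rewrite addr_gt0// ltr_wpDl.
    have G0 := Gamma_gt0 y1.
    rewrite rGammaE// powR_exp_ln ?mulr_gt0 ?expR_gt0// -[X in X^-1](lnK G0) -expRN.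
    rewrite [ln (_ * expR _)]lnM ?posrE ?mulr_gt0 ?expR_gt0// expRK /k
      /poisson_weight -!expRD.
    by congr ((expR _)%:E); ring.
  rewrite /nu /Rintegral E fineK//.
  rewrite ge0_integralMl; [|exact: measurable_itv|exact: expR_ge0|exact: mw|exact: w0].
  by rewrite fin_numM.
rewrite N; move: (fine _) => r; rewrite /k !mulrA -!expRD.
by rewrite [X in expR X](_ : _ = 0) ?expR0 ?mul1r//; ring.
Qed.

Lemma mean_cdf_series (t : R) : 0 < t ->
  (mean_cdf t = (expR (- (b * t)))%:E * \sum_(0 <= n <oo)
    (expR (kappa * n%:R) * nu (b * t * expR (- kappa)) n%:R)%:E)%E.
Proof.
move=> t0.
have nu0 (n : nat) : 0 <= expR (kappa * n%:R) * nu (b * t * expR (- kappa)) n%:R.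
  rewrite -(pmulr_rge0 _ (expR_gt0 (- (b * t)))) -lee_fin -nu_series_term//.
  by apply: integral_ge0 => y _; rewrite lee_fin mulr_ge0 ?expR_ge0.
rewrite -nneseriesZl; last by move=> n _; rewrite lee_fin.
under eq_eseriesr do rewrite -EFinM -nu_series_term//.
rewrite -integral_nneseries; [|exact: measurable_itv| |]; last 2 first.
- by move=> n; apply: measurable_funTS; rewrite /poisson_weight; measurability.
- by move=> n y _; rewrite lee_fin mulr_ge0 ?expR_ge0.
apply: eq_integral => y /inDP y0.
rewrite EFinM -nneseries_poisson_weight// -nneseriesZl; last first.
  by move=> n _; rewrite lee_fin expR_ge0.
by apply: eq_eseriesr => n _; rewrite EFinM.
Qed.

Lemma mean_cdf_nu (t : R) : 0 < t ->
  ((b * expR (- kappa))%:E * \int[mu]_(s in `]0%R, t[)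
    (expR (- (b * s)) * nu (b * s * expR (- kappa)) (- 1))%:E = mean_cdf t)%E.
Proof.
move=> t0; pose K := b * expR (- kappa).
have K0 : 0 < K by rewrite mulr_gt0 ?expR_gt0.
have -> : (\int[mu]_(s in `]0%R, t[)
    (expR (- (b * s)) * nu (b * s * expR (- kappa)) (- 1))%:E =
    \int[mu]_(s in `]0%R, t[) (K^-1 * resolvent s)%:E)%E.
  apply: eq_integral => s; rewrite inE/= in_itv/= => /andP[s0 _].
  by rewrite -resolvent_nu// -/K mulKf// lt0r_neq0.
rewrite ge0_integralMl; [|exact: measurable_itv|by rewrite invr_ge0 ltW
  |exact: measurable_resolvent|by move=> s; exact: resolvent_ge0].
by rewrite muleA -EFinM divff ?lt0r_neq0// mul1e -integral_indic_lt
  integral_resolvent_lt.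
Qed.

End representation.

(** * The inverse gamma process *)

Section inverse_gamma_process.
Context {R : realType} {d : measure_display} {T : measurableType d}.
Variables (P : probability T R) (H : R -> {RV P >-> R}) (a b c : R).
Hypotheses (a0 : 0 < a) (b0 : 0 < b) (c0 : 0 < c)
  (gamH : gamma_subordinator a b H).
Local Notation mu := (@lebesgue_measure R).
Local Notation D := (`]0%R, +oo[%classic : set R).
Local Notation kappa := (c / a).

Let subH : subordinator H. Proof. by have [] := gamH. Qed.

Let H_ge0 w (s : R) : 0 <= s -> 0 <= H s w.
Proof.
by move=> s0; rewrite -(subordinator0 subH w) (subordinator_nondecreasing subH).
Qed.

Let measurable_H (s : R) : measurable_fun setT (H s).
Proof. exact: measurable_funPT. Qed.

Let laplace_H (s l : R) : 0 <= s -> 0 <= l ->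
  (\int[P]_w (1 * expR (- (l * H s w)))%:E =
   (expR (- (a * s * ln (1 + l / b))))%:E)%E.
Proof.
move=> s0 l0; have [_ /(_ s l s0 l0)] := gamH; rewrite unlock /Phi => E.
rewrite (_ : a * s * ln (1 + l / b) = s * (a * ln (1 + l / b))) -?E; last by ring.
by apply: eq_integral => w _; rewrite mul1r.
Qed.

Let measurable_H_ge (s t : R) : measurable [set w | t <= H s w].
Proof.
rewrite -[X in measurable X]setTI.
by apply: measurable_fun_le => //; exact: measurable_cst.
Qed.

Let measurable_H_le (s t : R) : measurable [set w | H s w <= t].
Proof.
rewrite -[X in measurable X]setTI.
by apply: measurable_fun_le => //; exact: measurable_cst.
Qed.

Let lt_setC (s t : R) : [set w | H s w < t] = ~` [set w | t <= H s w].
Proof. by apply/seteqP; split => w /=; rewrite ltNge => /negP. Qed.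

Let prob_lt (s t : R) : 0 < s -> 0 < t ->
  P [set w | H s w < t] = (gcdf b (a * s) t)%:E.
Proof.
move=> s0 t0; have as0 : 0 < a * s by rewrite mulr_gt0.
rewrite (gcdf_fin b0 t as0).
rewrite -(@laplace_gamma_cdf _ b b0 _ _ P setT (fun=> 1) (H s) (a * s) t)//;
  [|by move=> w _; exact/H_ge0/ltW|by move=> l l0; exact/laplace_H/l0/ltW].
have mI : measurable [set w | H s w < t].
  by rewrite lt_setC; apply: measurableC; exact: measurable_H_ge.
rewrite -[LHS]/(P _) -[X in P X]setIT -integral_indic//.
by apply: eq_integral => w _; rewrite mul1r indicE; congr ((nat_of_bool _)%:R%:E);
  apply/idP/idP; rewrite inE.
Qed.

Let prob_ge (s t : R) : 0 < s -> 0 < t ->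
  P [set w | t <= H s w] = (1 - gcdf b (a * s) t)%:E.
Proof.
move=> s0 t0.
have -> : [set w | t <= H s w] = ~` [set w | H s w < t] by rewrite lt_setC setCK.
rewrite probability_setC ?prob_lt//.
by rewrite lt_setC; apply: measurableC; exact: measurable_H_ge.
Qed.

(* Where [H] stays at 0 for a while, the first exit time is 0. *)
Let degenerate : set T := \bigcup_n [set w | H n.+1%:R^-1 w <= 0].

(** On this event [expR (- (l * H s))] is 1, so its expectation bounds the probability for every
    [l]. Taking [l = b * (expR n - 1)] makes [1 + l / b = expR n] and the bound
    [expR (- (a * s * n))], which tends to 0. *)
Let prob_le0 (s : R) : 0 < s -> P [set w | H s w <= 0] = 0.
Proof.
move=> s0; have as0 : 0 < a * s by rewrite mulr_gt0.
have mI := measurable_H_le s 0.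
have ub (n : nat) : (P [set w | (H s w <= 0)%R] <= (expR (- (a * s * n%:R)))%:E)%E.
  have n0 : 0 <= expR n%:R - 1 :> R.
    by rewrite subr_ge0 -expR0 ler_expR.
  have := laplace_H (ltW s0) (mulr_ge0 (ltW b0) n0).
  have -> : 1 + b * (expR n%:R - 1) / b = expR n%:R.
    by field; exact: lt0r_neq0.
  rewrite expRK => <-.
  rewrite -[X in P X]setIT -integral_indic//.
  apply: ge0_le_integral; [exact: measurableT|by move=> w _; rewrite lee_fin
    |by apply/measurable_EFinP|by measurability; exact: measurable_H|].
  move=> w _; rewrite lee_fin mul1r indicE.
  case: (boolP (w \in _)) => [|_]; last exact: expR_ge0.
  rewrite inE/= => Hw.
  have -> : H s w = 0 by apply/eqP; rewrite eq_le Hw/=; exact/H_ge0/ltW.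
  by rewrite mulr0 oppr0 expR0.
apply/eqP; rewrite eq_le measure_ge0 andbT; apply/lee_addgt0Pr => e e0.
rewrite add0e; apply: le_trans (ub (Num.truncn (a * s * e)^-1).+1) _; rewrite lee_fin.
set n := _.+1; have n0 : 0 < n%:R :> R by [].
have nlt : (a * s * e)^-1 < n%:R by rewrite truncnS_gt.
rewrite expRN -[leRHS]invrK lef_pV2 ?posrE ?expR_gt0 ?invr_gt0//.
apply: le_trans (expR_ge1Dx _); apply: (@le_trans _ _ (a * s * n%:R)); last lra.
rewrite -ler_pdivrMl//; apply/ltW; apply: le_lt_trans nlt.
by rewrite -invfM.
Qed.

Let measurable_degenerate : measurable degenerate.
Proof. by apply: bigcupT_measurable => n; exact: measurable_H_le. Qed.

Let prob_degenerate : P degenerate = 0.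
Proof.
apply/measure_negligible; first exact: measurable_degenerate.
apply: negligible_bigcup => n; apply/negligibleP; first exact: measurable_H_le.
by apply: prob_le0; rewrite invr_gt0.
Qed.

Variable t : R.
Hypothesis t0 : 0 < t.
Let L := inverse_process (fun s => H s : T -> R) t.

Let LE w : L w =
  ereal_inf [set s%:E | s in [set s : R | 0 < s /\ ~ (0 < H s w < t)]].
Proof. by rewrite /L /inverse_process gt_eqF. Qed.

Let L_ge0 w : (0 <= L w)%E.
Proof.
by rewrite LE; apply: le_ereal_inf_tmp => _ [s [s0 _] <-]; rewrite lee_fin ltW.
Qed.

Let L_le (s : R) : 0 < s ->
  [set w | (L w <= s%:E)%E] = [set w | t <= H s w] `|` degenerate.
Proof.
move=> s0; apply/seteqP; split => w /=; last first.
  case=> [tH|[n _ /= Hn]]; rewrite LE.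
    by apply: ereal_inf_lbound; exists s => //; split => // /andP[_]; rewrite ltNge tH.
  (* [H] vanishes up to time [1 / (n + 1)], so [r] is a positive time, at most [s], outside []0,
     t[]. *)
  pose r := Num.min s n.+1%:R^-1.
  have r0 : 0 < r by rewrite lt_min s0 invr_gt0 ltr0n.
  apply: (@le_trans _ _ r%:E); last by rewrite lee_fin ge_min lexx.
  apply: ereal_inf_lbound; exists r => //; split => // /andP[+ _];
    rewrite ltNge => /negP; apply.
  apply: le_trans Hn; apply: (subordinator_nondecreasing subH); first exact: ltW.
  by rewrite ge_min lexx orbT.
move=> Ls; have [dw|ndw] := pselect (degenerate w); [by right|left].
have Hpos (r : R) : 0 < r -> 0 < H r w.
  move=> r0; rewrite ltNge; apply/negP => Hr; apply: ndw.
  exists (Num.truncn r^-1) => //=; apply: le_trans Hr.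
  apply: (subordinator_nondecreasing subH); first by rewrite invr_ge0.
  by rewrite -[leRHS]invrK lef_pV2 ?posrE ?invr_gt0// ltW// truncnS_gt.
(* The infimum need not be attained, so the bound is available only after [s]; right continuity
   carries it to [s]. *)
have Hge (r : R) : s < r -> t <= H r w.
  move=> sr; have : (L w < r%:E)%E by apply: le_lt_trans Ls _; rewrite lte_fin.
  rewrite LE => /ereal_inf_lt[_ [q [q0 Hq] <-]]; rewrite lte_fin => qr.
  have tq : t <= H q w by rewrite leNgt; apply/negP => qt; apply: Hq; rewrite Hpos.
  apply: le_trans tq _.
  by apply: (subordinator_nondecreasing subH); [exact: ltW|exact: ltW].
have rc : H r w @[r --> s^'+] --> H s w.
  exact: (subordinator_right_continuous subH (ltW s0)).
apply: (cvgr_to_ge rc).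
near=> r; apply: Hge; near: r; exact: nbhs_right_gt.
Unshelve. all: by end_near. Qed.

Let measurable_L : measurable_fun setT L.
Proof.
apply: (measurability _ (ErealGenOInfty.measurableE R)) => _ /= -[_ [x ->] <-].
rewrite setTI.
suff mLx : measurable [set w | (L w <= x%:E)%E].
  rewrite (_ : _ @^-1` _ = ~` [set w | (L w <= x%:E)%E]); first exact: measurableC.
  apply/seteqP; split => w /=; rewrite in_itv/= andbT ltNge => /negP//.
have pos (s : R) : 0 < s -> measurable [set w | (L w <= s%:E)%E].
  by move=> s0; rewrite L_le//; exact: measurableU.
have [x0|x0|<-] := ltgtP 0 x; first exact: pos.
- rewrite (_ : [set w | _] = set0) //; apply/seteqP; split => // w /= Lx.
  by have := le_trans (L_ge0 w) Lx; rewrite lee_fin leNgt x0.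
(* [L_le] asks for a positive time, so the event at 0 is reached as an intersection. *)
- rewrite (_ : [set w | _] = \bigcap_n [set w | (L w <= (n.+1%:R^-1)%:E)%E]).
    by apply: bigcap_measurableType => n _; apply: pos; rewrite invr_gt0.
  apply/seteqP; split => w /=.
    by move=> L0 n _ /=; apply: le_trans L0 _; rewrite lee_fin.
  move=> HL; apply/lee_addgt0Pr => e e0; rewrite add0e.
  apply: le_trans (HL (Num.truncn e^-1) I) _; rewrite lee_fin.
  by rewrite -[leRHS]invrK lef_pV2 ?posrE ?invr_gt0// ltW// truncnS_gt.
Qed.

Let prob_L_le (s : R) : 0 < s ->
  P [set w | (L w <= s%:E)%E] = (1 - gcdf b (a * s) t)%:E.
Proof.
by move=> s0; rewrite L_le// measureU0//; exact: prob_ge.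
Qed.

(** Writing the exponential as an integral of indicators reduces the expectation to the
    probabilities of [L <= s]. The formula includes [L w = +oo], where both sides are 0. *)
Let expeR_L w : (expeR (- (c%:E * L w)) =
  \int[mu]_(s in D) (c * (expR (- (c * s)) * (L w <= s%:E)%E%:R))%:E)%E.
Proof.
have := L_ge0 w; case: (L w) => [r| |//].
- rewrite lee_fin => r0.
  rewrite ge0_integralMl; [|exact: measurable_itv|exact: ltW
    |by measurability|by move=> z; rewrite mulr_ge0 ?expR_ge0].
  rewrite integral_indic_ge//; last by measurability.
  rewrite integral_expRN_gt// -!EFinM -EFinN; congr EFin; field.
  exact: lt0r_neq0.
- move=> _; rewrite gt0_muley ?lte_fin//=.
  by rewrite integral0_eq// => s _; rewrite !mulr0.
Qed.

Let integrand (p : T * R) : \bar R :=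
  (c * (expR (- (c * p.2)) * (L p.1 <= p.2%:E)%E%:R))%:E.

Let measurable_integrand : measurable_fun setT integrand.
Proof.
apply/measurable_EFinP; apply: measurable_funM => //; apply: measurable_funM.
  by measurability.
apply: (measurableT_comp measurable_natr_bool); apply: measurable_fun_lee.
  by apply: (measurableT_comp measurable_L).
by apply: measurableT_comp.
Qed.

(** The substitution [y = a * s] turns the rate [c] into [kappa = c / a], which explains why only
    this quotient enters the solution. *)
Let integral_scaled_gcdf :
  (\int[mu]_(s in D) (c * (expR (- (c * s)) * gcdf b (a * s) t))%:E =
   kappa%:E * mean_cdf b kappa t)%E.
Proof.
pose f (y : R) := (c * (expR (- (kappa * y)) * gcdf b y t))%:E.
have mg := measurable_mean_cdf_integrand b kappa t.
transitivity (\int[mu]_(s in D) f (a * s)%R)%E.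
  apply: eq_integral => s _; rewrite /f; have -> // : kappa * (a * s) = c * s.
  by field; exact: lt0r_neq0.
rewrite ge0_integral_scale//; last 2 first.
- by apply/measurable_EFinP; exact: measurable_funM.
- by move=> y; rewrite lee_fin; apply: mulr_ge0; [exact: ltW
  |exact: mean_cdf_integrand_ge0].
rewrite ge0_integralMl; [|exact: measurable_itv|exact: ltW|exact: mg
  |by move=> y; exact: mean_cdf_integrand_ge0].
by rewrite muleA -EFinM mulrC.
Qed.

Theorem laplace_inverse_gamma :
  (\int[P]_w expeR (- (c%:E * inverse_process (fun s => H s : T -> R) t w)) =
   (relaxation a b c t)%:E)%E.
Proof.
have kappa0 : 0 < kappa by rewrite divr_gt0.
have i0 p : (0 <= integrand p)%E by rewrite lee_fin !mulr_ge0 ?expR_ge0 ?(ltW c0).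
transitivity (\int[P]_(w in setT) \int[mu]_(s in D) integrand (w, s))%E.
  by apply: eq_integral => w _; rewrite -expeR_L.
rewrite (@fubini_tonelli_on _ _ _ _ _ P mu setT D integrand)//.
have -> : (\int[mu]_(s in D) \int[P]_(w in setT) integrand (w, s) =
    \int[mu]_(s in D) (c * (expR (- (c * s)) * (1 - gcdf b (a * s) t)))%:E)%E.
  apply: eq_integral => s /inDP s0.
  have mI : measurable [set w | (L w <= s%:E)%E].
    by rewrite L_le//; apply: measurableU => //; exact: measurable_H_ge.
  rewrite !EFinM -prob_L_le// -[X in P X]setIT -integral_indic//.
  rewrite muleA -EFinM -ge0_integralMl//; last by rewrite mulr_ge0 ?expR_ge0 ?(ltW c0).
  apply: eq_integral => w _; rewrite /integrand/= mulrA indicE.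
  by congr ((_ * (nat_of_bool _)%:R)%:E); apply/idP/idP; rewrite inE.
have mc : measurable_fun setT (fun s => gcdf b (a * s) t).
  by apply: (measurableT_comp (measurable_gcdf b t)); measurability.
have g1 s : 0 < s -> gcdf b (a * s) t <= 1.
  by move=> s0; apply: gcdf_le1 => //; rewrite mulr_gt0.
have total : (\int[mu]_(s in D) (c * expR (- (c * s)))%:E = 1)%E.
  rewrite ge0_integralMl; [|exact: measurable_itv|exact: ltW
    |by measurability|by move=> y; exact: expR_ge0].
  by rewrite integral_expRN_gt// -EFinM mulr0 oppr0 expR0 mulrA mulr1 divff ?lt0r_neq0.
have := integral_scaled_gcdf; rewrite -(fineK (mean_cdf_fin b0 kappa0 t)) -EFinM => J.
rewrite /relaxation resolvent_primitiveE// EFinB -J -total -integralB.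
- apply: eq_integral => s _; rewrite -EFinB; congr EFin.
  by move: (gcdf _ _ _) => g; ring.
- exact: measurable_itv.
- apply: ge0_integrable.
  + by apply: measurable_funTS; measurability.
  + by move=> s _; rewrite lee_fin mulr_ge0 ?expR_ge0 ?(ltW c0).
  + by rewrite total ltry.
- apply: ge0_integrable.
  + apply/measurable_EFinP; apply: measurable_funTS; apply: measurable_funM => //.
    by apply: measurable_funM => //; measurability.
  + by move=> s _; rewrite lee_fin !mulr_ge0 ?expR_ge0 ?(ltW c0) ?gcdf_ge0.
  + by rewrite J ltry.
Qed.

End inverse_gamma_process.

(** * Existence, uniqueness and the representations of the solution *)

Theorem theorem12 (R : realType) (a b c : R) (ha : 0 < a) (hb : 0 < b)
    (hc : 0 < c) :
  (exists u : R -> R, caputo_solution a b c u) /\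
  forall u : R -> R, caputo_solution a b c u ->
    [/\ forall v : R -> R, caputo_solution a b c v ->
          forall t, 0 <= t -> v t = u t,
        forall (d : measure_display) (T : measurableType d)
            (P : probability T R) (H : R -> {RV P >-> R}),
          gamma_subordinator a b H ->
          forall t, 0 <= t ->
            (u t)%:E =
            (\int[P]_w expeR (- (c%:E * inverse_process H t w)))%E &
        forall t, 0 < t ->
          (u t)%:E =
            (1 - (c / a * expR (- (b * t)))%:E *
                 \sum_(0 <= n <oo)
                   (expR (c / a * n%:R) * nu (b * t * expR (- (c / a))) n%:R)%:E)%E
          /\
          (u t)%:E =
            (1 - (b * (c / a) * expR (- (c / a)))%:E *
                 \int[lebesgue_measure]_(s in `]0%R, t[)
                   (expR (- (b * s)) * nu (b * s * expR (- (c / a))) (- 1))%:E)%E].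
Proof.
split; first by exists (relaxation a b c); exact: relaxation_solution.
move=> u solu; have kappa0 : 0 < c / a by rewrite divr_gt0.
have uE t : 0 <= t -> u t = relaxation a b c t by exact: (caputo_solution_unique ha hb hc).
split=> [v solv t tge0|d T P H gamH t|t t0].
- by rewrite uE//; exact: (caputo_solution_unique ha hb hc).
(* At [t = 0] the inverse process is 0 by definition and both sides are 1. *)
- rewrite le_eqVlt => /predU1P[<-|t0]; last first.
    by rewrite (uE _ (ltW t0)) -(laplace_inverse_gamma ha hb hc gamH t0).
  rewrite uE// /relaxation resolvent_primitive0 mulr0 subr0.
  under eq_integral do rewrite /inverse_process eqxx mule0 oppe0 /= expR0.
  by rewrite integral_cst// mul1e; exact/esym/probability_setT.
(* Both formulas in (ii) rewrite the same quantity: the series expands [G_y] under the integral over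
   [y], the integral formula rewrites [r] itself. *)
have uM : (u t)%:E = (1 - (c / a)%:E * mean_cdf b (c / a) t)%E.
  rewrite (uE _ (ltW t0)) /relaxation resolvent_primitiveE// EFinB EFinM.
  by rewrite fineK//; exact: mean_cdf_fin.
rewrite uM; split; congr (1 - _)%E.
- by rewrite (mean_cdf_series hb kappa0 t0) muleA -EFinM.
- rewrite -(mean_cdf_nu hb kappa0 t0) muleA -EFinM; congr (_%:E * _)%E; ring.
Qed.
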